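(* As $n\to\infty$ over the positive integers, $$f(n,3)=3^{n/2+o(n)}.$$ Moreover, for every $\varepsilon>0$ there exist $\delta,n_0>0$ such that for all integers $n\ge n_0$, whenever $A\subseteq[n]$ satisfies $f(A,3)\ge f(n,3)\cdot 2^{-\delta n}$, we have either $|A\triangle O|\le\varepsilon n$ or $|A\triangle I_2|\le \varepsilon n$.
   Context: $[n]=\{1,\ldots,n\}$. A Schur triple (sum) in a set $S\subseteq\mathbb{Z}$ is a triple $\{x,y,z\}\subseteq S$ of not necessarily distinct elements with $x+y=z$; a set is sum-free if it contains no Schur triple. For $A\subseteq[n]$ and a positive integer $r$, a colouring $\sigma:A\to[r]$ is valid if $\sigma^{-1}(c)$ is sum-free for every $c\in[r]$; $f(A,r)$ is the number of valid colourings of $A$ and $f(n,r)=\max_{A\subseteq[n]}f(A,r)$. $O$ denotes the set of odd integers in $[n]$, $I_2=\{\lfloor n/2\rfloor+1,\ldots,n\}$, and $\triangle$ denotes symmetric difference. *)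

(* Defs.v *)
From mathcomp Require Import all_boot.

Set Implicit Arguments.
Unset Strict Implicit.
Unset Printing Implicit Defensive.

(* Subsets of {0, ..., n} are represented as [{set 'I_n.+1}], an ordinal denoting
   the integer of the same value; those contained in [oneto n] are the subsets of
   [n] = {1, ..., n}. *)
Definition oneto (n : nat) : {set 'I_n.+1} := [set x : 'I_n.+1 | 0 < x].

(* [oddset n] is O and [uphalfset n] is I_2. *)
Definition oddset (n : nat) : {set 'I_n.+1} := [set x : 'I_n.+1 | odd x].

Definition uphalfset (n : nat) : {set 'I_n.+1} := [set x : 'I_n.+1 | n %/ 2 + 1 <= x].

Definition symdiff (T : finType) (A B : {set T}) : {set T} :=
  (A :\: B) :|: (B :\: A).

(* The sum is taken in [nat], with no reduction modulo n.+1; x and y may be equal. *)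
Definition sum_free (n : nat) (S : {set 'I_n.+1}) : bool :=
  [forall x in S, forall y in S, forall z in S, (x : nat) + (y : nat) != z].

(* Colourings are functions on A itself, so points outside A are not counted. *)
Definition colouring (n : nat) (A : {set 'I_n.+1}) (r : nat) :=
  {ffun {x : 'I_n.+1 | x \in A} -> 'I_r}.

Definition colour_class (n : nat) (A : {set 'I_n.+1}) (r : nat)
    (s : colouring A r) (c : 'I_r) : {set 'I_n.+1} :=
  [set val x | x : {x : 'I_n.+1 | x \in A} & s x == c].

Definition valid (n : nat) (A : {set 'I_n.+1}) (r : nat) (s : colouring A r) : bool :=
  [forall c : 'I_r, sum_free (colour_class s c)].

Definition nvalid (n : nat) (A : {set 'I_n.+1}) (r : nat) : nat :=
  #|[set s : colouring A r | valid s]|.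

Definition max_nvalid (n r : nat) : nat :=
  \max_(A : {set 'I_n.+1} | A \subset oneto n) nvalid A r.

(* Main.v *)
Require Import Defs.
From mathcomp Require Import all_boot all_order all_algebra.
From mathcomp Require Import ring lra zify.

(* By a graph-container argument every sum-free subset of [n] lies in one of
   2^{o(n)} sets of size at most (1/2 + o(1)) n.  Fix a triple of containers for the
   three colour classes and let p(x) be the number of those containing x; the number
   of compatible colourings of A is the product of the p(x) over A.  Since p^3 <= 3^p
   and the p(x) sum to at most (3/2 + o(1)) n, that product is at most 3^{n/2 + o(n)},
   and it is exponentially smaller unless p = 3 on almost all of A, which forces
   |A| <= (1/2 + o(1)) n.  For such an A, each of k disjoint Schur triples costs a
   factor 8/9 against the trivial bound 3^|A|, so a near-extremal A becomes a sum-free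
   set of size (1/2 - o(1)) n after deleting few elements.

   It remains to see that a sum-free S of size k close to n/2 is close to O or I_2.
   The positive differences of S avoid S.  Put a = min S, m = max S, l = m - a and
   view B = (S \ {m}) - a in Z/l: counting differences shows that at least
   l + 3k - 2n - 1 shifts r make B + r disjoint from B.  If no shift does, then l is
   close to n/2, so S is nearly an upper half interval.  Otherwise
   u(h) = |B \ (B + h)| is a subadditive function taking almost only values near 0
   and near |B|; the set where it is small is a subgroup of index 2, and S lies
   almost entirely in one residue class mod 2, necessarily the odd one. *)

Set Implicit Arguments.
Unset Strict Implicit.
Unset Printing Implicit Defensive.

Import GRing.Theory.

(** * Stability of large sum-free sets *)

Section ShiftDefect.
#[local] Open Scope ring_scope.
Variables (V : finZmodType) (B : {set V}).

Definition shift_defect (h : V) : nat := #|[set x in B | x + h \notin B]|.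
Definition shift_overlap (h : V) : nat := #|[set x in B | x + h \in B]|.
Local Notation u := shift_defect.
Local Notation c := shift_overlap.
Local Notation b := #|B|.

Lemma shift_defectE h : (u h + c h = b)%N.
Proof.
rewrite addnC -[RHS](cardsID [set x | x + h \in B]) /u /c.
congr (_ + _)%N; apply: eq_card => x; rewrite !inE //.
by rewrite andbC.
Qed.

Lemma shift_overlapN h : c (- h) = c h.
Proof.
rewrite /c -(card_imset [set x in B | x + h \in B] (addIr h)).
apply: eq_card => x; rewrite !inE; apply/andP/imsetP.
  by case=> xB xhB; exists (x - h); rewrite ?subrK // inE subrK xhB.
by case=> y; rewrite inE => /andP[yB yhB] ->; rewrite addrK.
Qed.

Lemma shift_defectN h : u (- h) = u h.
Proof.
by apply/eqP; rewrite -(eqn_add2r (c h)) -{1}shift_overlapN !shift_defectE.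
Qed.

(** If x leaves B under h + k, then either x leaves B under h, or x + h stays in B and leaves it
    under k. *)
Lemma shift_defectD h k : (u (h + k)%R <= u h + u k)%N.
Proof.
rewrite /u -(cardsID [set x | x + h \in B] [set x in B | _]) addnC.
apply: leq_add.
  by apply/subset_leq_card/subsetP => x; rewrite !inE => /and3P[-> ->].
rewrite -(card_imset (mem (_ :&: _)) (addIr h)).
apply/subset_leq_card/subsetP => _ /imsetP[x + ->].
by rewrite !inE addrA => /andP[/andP[_ ->] ->].
Qed.

(** Each ordered pair of elements of B is counted exactly once, at its difference. *)
Lemma sum_shift_overlap : (\sum_h c h = b * b)%N.
Proof.
transitivity (\sum_h \sum_(x in B) ((x + h)%R \in B))%N.
  apply: eq_bigr => h _; rewrite /c -sum1dep_card big_mkcondr /=.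
  by apply: eq_bigr => x _; case: ifP.
rewrite exchange_big /= -sum_nat_const; apply: eq_bigr => x _.
rewrite (reindex_inj (addrI (- x))) /=.
rewrite -sum1_card [RHS]big_mkcond /=; apply: eq_bigr => y _.
by rewrite addrA addrN add0r; case: ifP.
Qed.

(** The complement is the difference set B - B, so an upper bound on its size is a small-doubling
    hypothesis. *)
Definition full_shifts : {set V} := [set h | u h == b].
Local Notation R := full_shifts.

Lemma sum_shift_defectC : (\sum_(h in ~: R) u h + b * b = b * #|~: R|)%N.
Proof.
rewrite -sum_shift_overlap [X in (_ + X)%N](bigID (mem (~: R))) /=.
rewrite [X in (_ + (_ + X))%N]big1 => [|h]; last first.
  rewrite !inE negbK => /eqP uh; apply/eqP; rewrite -(eqn_add2l (u h)).
  by rewrite shift_defectE uh addn0.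
rewrite addn0 -big_split /= mulnC -sum_nat_const.
by apply: eq_bigr => h _; rewrite shift_defectE.
Qed.

Lemma card_full_shiftsC_ge : (0 < b)%N -> (b <= #|~: R|)%N.
Proof.
move=> b0; rewrite -(leq_pmul2l b0) -sum_shift_defectC leq_addl //.
Qed.

Lemma full_shifts_double : R != set0 -> (2 * b <= #|V|)%N.
Proof.
case/set0Pn => h; rewrite inE => /eqP uh.
have c0 : c h = 0%N by apply/eqP; rewrite -(eqn_add2l (u h)) shift_defectE uh addn0.
have /eqP := c0; rewrite cards_eq0 => /eqP c0'.
rewrite mul2n -addnn -{2}(card_imset B (addIr h)).
have dis : B :&: [set x + h | x : V in B] = set0.
  apply/setP => y; rewrite inE [RHS]inE; apply/negP => /andP[yB /imsetP[x xB yE]].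
  by move/setP/(_ x): c0'; rewrite !inE xB -yE yB.
by rewrite -cardsUI dis cards0 addn0 max_card.
Qed.

Variable tau : nat.
Hypotheses (cR : (#|~: R| <= b + tau)%N) (bt : (17 * tau < b)%N).

Local Notation G := [set h | (8 * u h <= b)%N].
(** Under the bounds on [tau], no defect lies in the range from b / 4 (excluded) to b / 2; this gap
    makes the set a subgroup. *)
Definition almost_periods : {set V} := [set h | (2 * u h <= b)%N].
Local Notation H := almost_periods.

Lemma sum_shift_defectC_le : (\sum_(h in ~: R) u h <= b * tau)%N.
Proof. by rewrite -(leq_add2r (b * b)) sum_shift_defectC -mulnDr leq_mul // addnC. Qed.

(** Markov's inequality: the total defect over B - B is at most b * tau, so at most 8 * tau elements
    of B - B have defect above b / 8. *)
Lemma card_good_periods : (b <= #|G| + 8 * tau)%N.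
Proof.
have b0 : (0 < b)%N by lia.
have sub : ~: R \subset G :|: (~: R :\: G).
  by apply/subsetP => x xR; rewrite inE in_setD xR andbT orbN.
have := leq_trans (card_full_shiftsC_ge b0) (leq_trans (subset_leq_card sub) (leq_card_setU _ _)).
move=> h1; apply: leq_trans h1 _; rewrite leq_add2l.
rewrite -(leq_pmul2l b0).
have : (b * #|~: R :\: G| <= 8 * \sum_(h in ~: R :\: G) u h)%N.
  rewrite mulnC -sum_nat_const big_distrr /=; apply: leq_sum => h.
  by rewrite !inE -ltnNge => /andP[/ltnW].
have : (\sum_(h in ~: R :\: G) u h <= \sum_(h in ~: R) u h)%N.
  by rewrite [leqRHS](big_setID G) /= leq_addl.
have := sum_shift_defectC_le; nia.
Qed.

(** G and G + h both lie in B - B, of size at most b + tau, and each has at least b - 8 tau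
    elements. As 17 tau < b they meet, so h is a difference of two shifts of defect at most b /
    8. *)
Lemma almost_periods_quarter h : h \in H -> (4 * u h <= b)%N.
Proof.
rewrite inE => uh.
have sub : G :|: [set x + h | x : V in G] \subset ~: R.
  apply/subsetP => x; rewrite !inE => /orP[?|/imsetP[y]]; first by lia.
  by rewrite inE => uy ->; have := shift_defectD y h; lia.
have [y] : exists y, y \in G :&: [set x + h | x : V in G].
  apply/set0Pn; rewrite -card_gt0.
  have := cardsUI G [set x + h | x : V in G]; rewrite (card_imset _ (addIr h)).
  by have := subset_leq_card sub; have := card_good_periods; lia.
rewrite !inE => /andP[uy /imsetP[z]]; rewrite inE => uz yE.
have -> : h = y + - z by rewrite yE addrC addrA addNr add0r.
by have := shift_defectD y (- z); rewrite shift_defectN; lia.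
Qed.

Lemma almost_periodsD h k : h \in H -> k \in H -> h + k \in H.
Proof.
move=> /almost_periods_quarter uh /almost_periods_quarter uk.
by rewrite inE; have := shift_defectD h k; lia.
Qed.

Lemma almost_periodsN h : (- h \in H) = (h \in H).
Proof. by rewrite !inE shift_defectN. Qed.

Lemma almost_periodsMn h k : h \in H -> h *+ k \in H.
Proof.
move=> hH; elim: k => [|k IH]; last by rewrite mulrS almost_periodsD.
rewrite mulr0n -(subrr h) almost_periodsD ?almost_periodsN //.
Qed.

Lemma card_almost_periods_ge : (b <= #|H| + 8 * tau)%N.
Proof.
apply: leq_trans card_good_periods _; rewrite leq_add2r.
by apply/subset_leq_card/subsetP => x; rewrite !inE; lia.
Qed.

Lemma almost_periods_full : H \subset ~: R.
Proof. by apply/subsetP => x; rewrite !inE; lia. Qed.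

(** Otherwise H, H + v and H + 2v would be three disjoint cosets. *)
Lemma almost_periods_index2 v : (#|V| < 3 * #|H|)%N -> v \notin H -> v *+ 2 \in H.
Proof.
move=> VH vH; apply: contraLR VH => v2H; rewrite -leqNgt.
pose Hv := [set x + v | x : V in H]; pose H2 := [set x + v *+ 2 | x in H].
have cv : #|Hv| = #|H| by rewrite card_imset //; apply: addIr.
have c2 : #|H2| = #|H| by rewrite card_imset //; apply: addIr.
have sub x y : x \in H -> y \in H -> x - y \in H.
  by move=> xH yH; rewrite almost_periodsD ?almost_periodsN.
have d1 : H :&: Hv = set0.
  apply/setP => x; rewrite inE in_set0; apply/negP => /andP[xH /imsetP[y yH xE]].
  move/negP: vH; apply; have -> : v = x - y by rewrite xE addrC addrA addNr add0r.
  exact: sub.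
have d2 : (H :|: Hv) :&: H2 = set0.
  apply/setP => x; rewrite !in_setI in_setU in_set0; apply/negP.
  case/andP=> /orP[xH|/imsetP[z zH xE]] /imsetP[y yH xE'].
    move/negP: v2H; apply; have -> : v *+ 2 = x - y by rewrite xE' addrC addrA addNr add0r.
    exact: sub.
  move/negP: vH; apply; have -> : v = z - y; last exact: sub.
  have -> : z = y + v by apply: (addIr v); rewrite -xE xE' -addrA -mulr2n.
  by rewrite [y + v]addrC addrK.
have := cardsUI (H :|: Hv) H2; have := cardsUI H Hv.
rewrite d1 d2 cards0 !addn0 cv c2 => -> e.
apply: leq_trans (max_card (mem ((H :|: Hv) :|: H2))); rewrite e; lia.
Qed.

End ShiftDefect.

(** * Parity classes in a cyclic group *)

Section CyclicParity.
Variables (p : nat) (B : {set 'I_p.+2}) (tau : nat).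
Local Notation R := (full_shifts B).
Local Notation H := (almost_periods B).
Hypotheses (cR : #|~: R| <= #|B| + tau) (bt : 25 * tau < #|B|).
Hypotheses (R0 : R != set0) (lB : p.+2 <= 2 * #|B| + tau).

Let bt17 : 17 * tau < #|B|. Proof. lia. Qed.
Let lb2 : 2 * #|B| <= p.+2.
Proof. by have := full_shifts_double R0; rewrite card_ord. Qed.

(** Since 1 generates the group, the whole group would otherwise lie in B - B, of size at most b +
    tau < 2b, while the modulus is at least 2b. *)
Lemma one_notin_almost_periods : (1%R : 'I_p.+2) \notin H.
Proof.
apply/negP => H1.
have HT : H = [set: 'I_p.+2].
  by apply/setP => x; rewrite in_setT -(natr_Zp x) (almost_periodsMn cR bt17).
have := subset_leq_card (almost_periods_full cR bt17).
by rewrite HT cardsT card_ord; lia.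
Qed.

Lemma even_almost_periods k : ~~ odd k -> (k%:R%R : 'I_p.+2) \in H.
Proof.
move=> ek; rewrite -(odd_double_half k) (negbTE ek) add0n -muln2 mulnC.
rewrite mulnC muln2 -mul2n natrM GRing.mulr_natr.
apply: (almost_periodsMn cR bt17); apply: (almost_periods_index2 cR bt17).
  (* Here 25 tau < b enters: the modulus is at most 2b + tau < 3 (b - 8 tau). *)
  rewrite card_ord; apply: (@leq_trans (3 * (#|B| - 8 * tau))); first by lia.
  by rewrite leq_mul2l leq_subLR addnC; exact: (card_almost_periods_ge cR bt17).
exact: one_notin_almost_periods.
Qed.

(** Modulo an odd p + 2, the even number p + 3 would represent 1. *)
Lemma cyclic_modulus_even : odd p = false.
Proof.
apply/negP => op; have /= := @even_almost_periods p.+3; rewrite negbK op => /(_ isT).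
rewrite -natr1 (_ : (p.+2%:R)%R = 0%R :> 'I_p.+2) ?add0r; last first.
  by apply: val_inj; rewrite Zp_nat /= modnn.
by rewrite (negbTE one_notin_almost_periods).
Qed.

Let oddD (x y : 'I_p.+2) : odd (x + y)%R = odd x (+) odd y.
Proof. by rewrite /= odd_mod ?oddD //= negbK cyclic_modulus_even. Qed.

Let card_parity (d : bool) : 2 * #|[set x : 'I_p.+2 | odd x == d]| = p.+2.
Proof.
pose P (d : bool) := [set x : 'I_p.+2 | odd x == d].
have PE d' : #|P d'| = #|P (~~ d')|.
  rewrite -(card_imset (mem (P d')) (addIr (1%R : 'I_p.+2))).
  apply: eq_card => x; rewrite !inE; apply/imsetP/idP.
    by case=> y; rewrite inE => /eqP yd ->; rewrite oddD yd /= addbT.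
  move=> /eqP xd; exists (x - 1)%R; last by rewrite subrK.
  have := oddD (x - 1)%R 1%R; rewrite subrK xd inE /= addbT => e.
  by apply/eqP/negb_inj.
rewrite -/(P d) mul2n -addnn {2}PE -[RHS]card_ord -(cardsC (P d)).
by congr (_ + _); apply: eq_card => x; rewrite !inE; case: odd d => -[].
Qed.

(** Sum the defects over even shifts. If B has e and o elements in the two classes, each of size l /
    2 >= b = e + o, then the sum e (l / 2 - e) + o (l / 2 - o) is at least 2 e o. It is at most b *
    tau, so one of e, o is at most tau. *)
Lemma cyclic_parity :
  #|[set x in B | odd x]| <= tau \/ #|[set x in B | ~~ odd x]| <= tau.
Proof.
pose P (d : bool) := [set x : 'I_p.+2 | odd x == d].
pose Bp d := [set x in B | odd x == d].
have -> : [set x in B | odd x] = Bp true by apply/setP => x; rewrite !inE eqb_id.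
have -> : [set x in B | ~~ odd x] = Bp false by apply/setP => x; rewrite !inE eqbF_neg.
have cB : #|Bp true| + #|Bp false| = #|B|.
  rewrite -(cardsID [set x : 'I_p.+2 | odd x] B).
  by congr (_ + _); apply: eq_card => x; rewrite !inE ?eqb_id // eqbF_neg andbC.
have cC d : #|P d :\: B| + #|Bp d| = #|P d|.
  rewrite -(cardsID B (P d)) addnC; congr (_ + _); apply: eq_card => x.
  by rewrite !inE andbC.
(* For fixed x in B, the points x + h with h even run once over the parity class of x. *)
have sE : \sum_(h in P false) shift_defect B h = \sum_(x in B) #|P (odd x) :\: B|.
  transitivity (\sum_(h in P false) \sum_(x in B) ((x + h)%R \notin B)).
    apply: eq_bigr => h _; rewrite /shift_defect -sum1dep_card big_mkcondr /=.
    by apply: eq_bigr => x _; case: ifP.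
  rewrite exchange_big /=; apply: eq_bigr => x _.
  rewrite [LHS]big_mkcond (reindex_inj (addrI (- x)%R)) /= -sum1_card [RHS]big_mkcond /=.
  apply: eq_bigr => y _; rewrite addrA addrN add0r !inE.
  have := oddD x (- x + y)%R; rewrite addrA addrN add0r => ->.
  by case: odd (odd _) => -[] /=; case: (y \in B).
have := sum_shift_defectC_le cR.
have sub : P false \subset ~: R.
  apply/subsetP => x; rewrite inE eqbF_neg => ex.
  apply: (subsetP (almost_periods_full cR bt17)).
  by rewrite -(natr_Zp x) even_almost_periods.
have : \sum_(h in P false) shift_defect B h <= \sum_(h in ~: R) shift_defect B h.
  by rewrite [leqRHS](big_setID (P false)) /= (setIidPr sub) leq_addr.
rewrite sE (bigID (fun x : 'I_p.+2 => odd x)) /=.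
rewrite (eq_bigr (fun=> #|P true :\: B|)) => [|x /andP[_ ->] //].
rewrite [X in _ + X](eq_bigr (fun=> #|P false :\: B|)) => [|x /andP[_ /negbTE ->] //].
have -> : \sum_(i in B | odd i) #|P true :\: B| = #|Bp true| * #|P true :\: B|.
  by rewrite -sum_nat_const; apply: eq_bigl => x; rewrite !inE eqb_id.
have -> : \sum_(i in B | ~~ odd i) #|P false :\: B| = #|Bp false| * #|P false :\: B|.
  by rewrite -sum_nat_const; apply: eq_bigl => x; rewrite !inE eqbF_neg.
have := cC true; have := cC false; have := card_parity true; have := card_parity false.
rewrite -/(P true) -/(P false).
move: cB bt lb2; move: #|P true :\: B| #|P false :\: B| #|P true| #|P false|.
move: #|Bp true| #|Bp false| #|B| #|~: R| => e o b _ x y Pt Pf.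
move=> *.
have xo : o <= x by lia.
have yo : e <= y by lia.
have : 2 * (e * o) <= b * tau by nia.
case: (leqP e tau) => [|et]; first by left.
case: (leqP o tau) => [|ot]; first by right.
nia.
Qed.

End CyclicParity.

(** * Size bounds for sets of integers *)

Lemma card_leq_inj_nat (T : finType) (X : {set T}) (f : T -> nat) (k : nat) :
  {in X &, injective f} -> (forall x, x \in X -> f x < k) -> #|X| <= k.
Proof.
move=> finj fk; rewrite cardE -(size_map f) -(size_iota 0 k).
apply: uniq_leq_size.
  by rewrite map_inj_in_uniq ?enum_uniq // => x y; rewrite !mem_enum; apply: finj.
by move=> _ /mapP[x + ->]; rewrite mem_enum mem_iota => /fk.
Qed.

Lemma sum_freeP n (S : {set 'I_n.+1}) :
  reflect (forall x y z, x \in S -> y \in S -> z \in S -> (x + y)%N <> z) (sum_free S).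
Proof.
apply: (iffP forall_inP) => [h x y z xS yS zS | h x xS].
  by apply/eqP; apply: (forall_inP (forall_inP (h x xS) y yS)).
by apply/forall_inP => y yS; apply/forall_inP => z zS; apply/eqP/h.
Qed.

Lemma sum_free_sub n (S S' : {set 'I_n.+1}) :
  S' \subset S -> sum_free S -> sum_free S'.
Proof.
move=> /subsetP sub /sum_freeP sf; apply/sum_freeP => x y z xS yS zS.
by apply: sf; apply: sub.
Qed.

(* [S] and its reflection [m - S] are disjoint. *)
Lemma card_sum_free_reflect n (S X : {set 'I_n.+1}) (m : 'I_n.+1) :
  sum_free S -> m \in S -> (forall x, x \in S -> x <= m) -> S \subset X ->
  (forall x, x \in S -> x != m -> inord (m - x) \in X) -> 2 * #|S| <= #|X|.+1.
Proof.
move=> /sum_freeP sf mS maxm SX reflX.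
have vE (x : 'I_n.+1) : nat_of_ord (inord (m - x) : 'I_n.+1) = m - x.
  by rewrite inordK // ltnS (leq_trans (leq_subr _ _)) // -ltnS.
pose S' := [set (inord (m - x) : 'I_n.+1) | x : 'I_n.+1 in S :\ m].
have cS' : #|S'| = #|S|.-1.
  rewrite (cardsD1 m S) mS; apply: card_in_imset => x y.
  rewrite !inE => /andP[_ /maxm xm] /andP[_ /maxm ym] /(congr1 val) /=.
  by rewrite !vE => e; apply: val_inj => /=; lia.
have dis : S :&: S' = set0.
  apply/setP => y; rewrite !inE; apply/negP => /andP[yS /imsetP[x]].
  rewrite !inE => /andP[_ xS] yE; apply: (sf x y m) => //.
  by rewrite yE vE; have := maxm x xS; lia.
have := cardsUI S S'; rewrite dis cards0 cS'.
have : #|S :|: S'| <= #|X|.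
  apply/subset_leq_card; rewrite subUset SX; apply/subsetP => _ /imsetP[x + ->].
  by rewrite !inE => /andP[xm xS]; apply: reflX.
have : 0 < #|S| by apply/card_gt0P; exists m.
by lia.
Qed.

(** When |S| is close to |X|, this reduces closeness of S and X to a bound on S \ X alone. *)
Lemma card_symdiff_le (T : finType) (S X : {set T}) :
  #|symdiff S X| + #|S| <= 2 * #|S :\: X| + #|X|.
Proof.
have h : #|symdiff S X| <= #|S :\: X| + #|X :\: S| by apply: leq_card_setU.
have := cardsID X S; have := cardsID S X; rewrite setIC; lia.
Qed.

Lemma card_oddset_le n : #|oddset n| <= n.+1./2.
Proof.
apply: (@card_leq_inj_nat _ _ (fun x : 'I_n.+1 => (nat_of_ord x)./2)) => [x y|x].
  by rewrite !inE => ox oy e; apply: val_inj => /=; lia.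
by rewrite inE; have := ltn_ord x; lia.
Qed.

Lemma card_oddset_ge n : n <= 2 * #|oddset n|.
Proof.
pose f (i : 'I_(n.+1./2)) : 'I_n.+1 := inord (i.*2.+1).
have fE (i : 'I_(n.+1./2)) : nat_of_ord (f i) = i.*2.+1.
  by rewrite inordK //; have := ltn_ord i; lia.
have finj : injective f.
  move=> i j /(congr1 (@nat_of_ord _)); rewrite !fE => -[/double_inj e].
  exact: ord_inj.
have : #|[set f i | i : 'I_(n.+1./2)]| <= #|oddset n|.
  apply/subset_leq_card/subsetP => _ /imsetP[i _ ->].
  by rewrite inE fE /= odd_double.
by rewrite card_imset // card_ord; lia.
Qed.

Lemma card_uphalfset_le n : #|uphalfset n| <= n.+1./2.
Proof.
apply: (@card_leq_inj_nat _ _ (fun x : 'I_n.+1 => x - (n %/ 2 + 1))) => [x y|x].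
  by rewrite !inE => ox oy e; apply: val_inj => /=; lia.
by rewrite inE; have := ltn_ord x; lia.
Qed.

(** The reflection argument stays within the positive even numbers, of which there are only n / 2.
    This later excludes the even residue class. *)
Lemma card_even_sum_free n (S : {set 'I_n.+1}) :
  S \subset oneto n -> sum_free S -> (forall x, x \in S -> ~~ odd x) ->
  4 * #|S| <= n + 2.
Proof.
move=> /subsetP S1 sf evS; have [->|/set0Pn[x0 x0S]] := eqVneq S set0.
  by rewrite cards0.
have [m mS maxm] := @arg_maxnP _ x0 (mem S) (fun x => nat_of_ord x) x0S.
have {}maxm x : x \in S -> x <= m by apply: maxm.
pose X := [set x : 'I_n.+1 | (0 < x) && ~~ odd x].
have cX : #|X| <= n./2.
  apply: (@card_leq_inj_nat _ _ (fun x : 'I_n.+1 => (nat_of_ord x)./2.-1)) => [x y|x].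
    by rewrite !inE => ox oy e; apply: val_inj => /=; lia.
  by rewrite inE; have := ltn_ord x; lia.
have := @card_sum_free_reflect n S X m sf mS maxm.
have sub : S \subset X.
  by apply/subsetP => x xS; have := S1 x xS; rewrite !inE => ->; rewrite evS.
move=> /(_ sub) h.
suff /h h2 : forall x, x \in S -> x != m -> inord (m - x) \in X.
  have : 2 * #|S| <= n./2.+1 by apply: leq_trans h2 _; rewrite ltnS.
  by lia.
move=> x xS xm; rewrite inE inordK; last first.
  by rewrite ltnS (leq_trans (leq_subr _ _)) // -ltnS.
have := maxm x xS; have := evS x xS; have := evS m mS.
by move: xm; rewrite -val_eqE /=; lia.
Qed.

(** * Differences of a sum-free set, seen modulo m - a *)

Section Differences.
Variables (n p : nat) (S : {set 'I_n.+1}) (a m : 'I_n.+1).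
Hypotheses (S1 : S \subset oneto n) (sf : sum_free S).
Hypotheses (aS : a \in S) (mS : m \in S) (lE : (m = a + p.+2 :> nat)%N).
Hypothesis (amS : forall x, x \in S -> a <= x <= m).

(** Only m is lost from S, since m = a + l has the same residue as a. The modulus l is written
    [p.+2] so that the ordinals form a ring. *)
Definition translate : {set 'I_p.+2} := [set r : 'I_p.+2 | inord (a + r) \in S].
Local Notation B := translate.

Let trE (r : 'I_p.+2) : nat_of_ord (inord (a + r) : 'I_n.+1) = a + r.
Proof. by rewrite inordK //; have := ltn_ord r; have := ltn_ord m; lia. Qed.

Let tr_inj : injective (fun r : 'I_p.+2 => inord (a + r) : 'I_n.+1).
Proof.
by move=> r s /(congr1 val) /=; rewrite !trE => e; apply: val_inj => /=; lia.
Qed.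

Lemma card_translate_sub (P : pred nat) :
  #|[set x in S | P x]| <= #|[set r in B | P (a + r)]|.+1.
Proof.
rewrite -(card_imset _ tr_inj) -[leqRHS]addn1 -(cards1 m).
apply: leq_trans (leq_card_setU _ _); apply/subset_leq_card/subsetP => x.
rewrite inE => /andP[xS Px]; rewrite !inE orbC.
have [//|/= xm] := eqVneq x m; apply/imsetP.
have /andP[ax xm'] := amS xS.
have xl : x - a < p.+2 by move: xm; rewrite -val_eqE /= => ?; lia.
exists (Ordinal xl); last by apply: ord_inj; rewrite trE /= subnKC.
rewrite !inE /= subnKC // Px andbT.
by rewrite (_ : inord x = x) //; apply: val_inj; rewrite /= inordK.
Qed.

Lemma card_translate : #|S| = #|B|.+1.
Proof.
apply/eqP; rewrite eqn_leq; apply/andP; split.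
  have := card_translate_sub predT; rewrite (_ : [set x in S | _] = S).
    by rewrite (_ : [set r in B | _] = B) //; apply/setP => x; rewrite inE andbT.
  by apply/setP => x; rewrite inE andbT.
rewrite -(card_imset _ tr_inj) (cardsD1 m S) mS add1n ltnS.
apply/subset_leq_card/subsetP => _ /imsetP[r + ->]; rewrite !inE => ->.
by rewrite andbT -val_eqE /= trE lE eqn_add2l neq_ltn ltn_ord.
Qed.

Let D := [set d : 'I_p.+2 | (0 < d) &&
  [exists x in S, [exists y in S, (x + d == y)%N]]].

(** By sum-freeness the differences avoid S. The extra 1 is the difference l = m - a, which has no
    representative below l and hence is not in D. *)
Let card_D : #|D| + #|S| + 1 <= n.
Proof.
pose g (d : 'I_p.+2) : 'I_n.+1 := inord d.
have gE d : nat_of_ord (g d) = d.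
  by rewrite inordK //; have := ltn_ord d; have := ltn_ord m; lia.
have ginj : injective g.
  by move=> r s /(congr1 val) /=; rewrite !gE => e; apply: val_inj.
pose l : 'I_n.+1 := inord p.+2.
have ll : nat_of_ord l = p.+2 by rewrite inordK //; have := ltn_ord m; lia.
have d1 : g @: D :&: S = set0.
  apply/setP => y; rewrite !inE; apply/negP => /andP[/imsetP[d + ->] dS].
  rewrite !inE => /andP[_ /exists_inP[x xS /exists_inP[z zS /eqP e]]].
  by apply: (sum_freeP _ sf x (g d) z) => //; rewrite gE.
have d2 : (g @: D :|: S) :&: [set l] = set0.
  apply/setP => y; rewrite !inE; apply/negP => /andP[yD /eqP yl].
  move: yD; rewrite {y}yl; case/orP => [/imsetP[d _ /(congr1 (@nat_of_ord _))]|lS].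
    by rewrite ll gE => e; have := ltn_ord d; rewrite -e ltnn.
  by apply: (sum_freeP _ sf a l m) => //; rewrite ll lE.
have := cardsUI (g @: D :|: S) [set l]; have := cardsUI (g @: D) S.
rewrite d1 d2 cards0 cards1 (card_imset _ ginj) !addn0 => <- <-.
apply: (@card_leq_inj_nat _ _ (fun x : 'I_n.+1 => x.-1)) => [x y|x]; last first.
  move=> h; have : 0 < x; last by have := ltn_ord x; lia.
  move: h; rewrite !inE => /orP[/orP[|/(subsetP S1)]|/eqP ->].
  - by case/imsetP => d; rewrite inE => /andP[d0 _] ->; rewrite gE.
  - by rewrite inE.
  - by rewrite ll.
have pos z : z \in (g @: D :|: S) :|: [set l] -> 0 < z.
  rewrite !inE => /orP[/orP[|/(subsetP S1)]|/eqP ->].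
  - by case/imsetP => d; rewrite inE => /andP[d0 _] ->; rewrite gE.
  - by rewrite inE.
  - by rewrite ll.
by move=> /pos x0 /pos y0 e; apply: val_inj => /=; lia.
Qed.

Local Notation R := (full_shifts B).

Let oppE (h : 'I_p.+2) : 0 < h -> nat_of_ord (- h)%R = p.+2 - h.
Proof. by move=> h0 /=; rewrite modn_small //; lia. Qed.

(** If x and x + h are both in B, then h is a positive difference when x + h does not wrap around,
    and l - h is one when it does. *)
Let R_sub : ~: R \subset [set 0%R] :|: (D :|: [set (- x)%R | x : 'I_p.+2 in D]).
Proof.
apply/subsetP => h; rewrite !inE => hR.
have [//|/= h0] := eqVneq h 0%R.
have h0' : 0 < h by move: h0; rewrite -val_eqE /= lt0n.
have [x] : exists x, (x \in B) && (x + h \in B)%R.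
  move: hR; rewrite -(shift_defectE B h) -{1}[shift_defect _ _]addn0 eqn_add2l.
  by rewrite eq_sym cards_eq0 => /set0Pn[x]; rewrite inE; exists x.
rewrite !inE => /andP[xS xhS].
have [lt|ge] := ltnP (x + h) p.+2.
  apply/orP; left; rewrite h0' /=; apply/exists_inP; exists (inord (a + x)) => //.
  apply/exists_inP; exists (inord (a + (x + h)%R)) => //.
  by rewrite !trE /= modn_small // addnA.
apply/orP; right; apply/imsetP; exists (- h)%R; last by rewrite opprK.
rewrite inE oppE // subn_gt0 ltn_ord /=.
apply/exists_inP; exists (inord (a + (x + h)%R)) => //.
apply/exists_inP; exists (inord (a + x)) => //.
rewrite !trE /= -{1}(subnK ge) modnDr modn_small; last by have := ltn_ord x; have := ltn_ord h; lia.
by have := ltn_ord h; lia.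
Qed.

Let zero_translate : 0%R \in B.
Proof.
by rewrite inE /= addn0 (_ : inord a = a) //; apply: val_inj; rewrite /= inordK.
Qed.

(** A nonzero r in B gives two differences: r = (a + r) - a and l - r = m - (a + r). *)
Let B_sub : B :\ 0%R \subset D :&: [set (- x)%R | x : 'I_p.+2 in D].
Proof.
apply/subsetP => h; rewrite !inE => /andP[h0 hS].
have h0' : 0 < h by move: h0; rewrite -val_eqE /= lt0n.
rewrite h0' /=; apply/andP; split.
  apply/exists_inP; exists a => //; apply/exists_inP; exists (inord (a + h)) => //.
  by rewrite trE.
apply/imsetP; exists (- h)%R; last by rewrite opprK.
rewrite inE oppE // subn_gt0 ltn_ord /=.
apply/exists_inP; exists (inord (a + h)) => //; apply/exists_inP; exists m => //.
by rewrite trE lE; have := ltn_ord h; lia.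
Qed.

(** Inclusion-exclusion for D and -D: [card_D] bounds |D|, and [B_sub] shows that the two overlap in
    at least |B| - 1 elements. *)
Lemma card_full_shiftsC_translate : #|~: R| + 3 * #|S| <= 2 * n + 1.
Proof.
have := subset_leq_card R_sub.
have := (leq_card_setU [set 0%R : 'I_p.+2] (D :|: [set (- x)%R | x : 'I_p.+2 in D])).1.
rewrite cards1.
have := cardsUI D [set (- x)%R | x : 'I_p.+2 in D].
rewrite [#|[set (- x)%R | x : 'I_p.+2 in D]|]card_imset; last exact: oppr_inj.
have := subset_leq_card B_sub; have := cardsD1 0%R B; rewrite zero_translate.
have := card_D; have := card_translate.
move: #|D| #|D :&: _| #|D :|: _| #|_ :|: (D :|: _)| #|B| #|B :\ _| #|~: R| => *.
lia.
Qed.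

End Differences.

Lemma sum_free_stability n (S : {set 'I_n.+1}) t :
  S \subset oneto n -> sum_free S -> 2 * n <= 4 * #|S| + t -> 100 * (t + 4) <= n ->
  #|symdiff S (oddset n)| <= 3 * t + 20 \/ #|symdiff S (uphalfset n)| <= 3 * t + 20.
Proof.
move=> S1 sf Sn tn.
have [x0 x0S] : exists x, x \in S by apply/card_gt0P; lia.
have [m mS maxm] := @arg_maxnP _ x0 (mem S) (fun x => nat_of_ord x) x0S.
have [a aS mina] := @arg_minnP _ x0 (mem S) (fun x => nat_of_ord x) x0S.
have {}maxm x : x \in S -> x <= m by apply: maxm.
have {}mina x : x \in S -> a <= x by apply: mina.
have amS x : x \in S -> a <= x <= m.
  by move=> xS; rewrite mina ?maxm.
have Sl : #|S| <= (m - a).+1.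
  apply: (@card_leq_inj_nat _ _ (fun x : 'I_n.+1 => x - a)) => [x y|x].
    by move=> /amS xS /amS yS e; apply: val_inj => /=; lia.
  by move=> /amS; lia.
have [p lE] : exists p, (m = a + p.+2 :> nat)%N by exists (m - a - 2); lia.
have mn : m <= n by rewrite -ltnS.
have a1 : 0 < a by have := subsetP S1 a aS; rewrite inE.
have cB := card_translate S1 sf aS mS lE amS.
have cR := card_full_shiftsC_translate S1 sf aS mS lE amS.
set B := translate p S a in cB cR.
(* Reflecting S inside [1, m] shows that m is close to n. *)
have m_big : 2 * #|S| <= m.+1.
  pose X := [set x : 'I_n.+1 | (0 < x) && (x <= m)].
  have cX : #|X| <= m.
    apply: (@card_leq_inj_nat _ _ (fun x : 'I_n.+1 => x.-1)) => [x y|x].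
      by rewrite !inE => ox oy e; apply: val_inj => /=; lia.
    by rewrite inE; lia.
  apply: leq_trans (_ : #|X|.+1 <= _); last by rewrite ltnS.
  apply: (card_sum_free_reflect sf mS maxm).
    apply/subsetP => x xS; rewrite inE; have := amS x xS; lia.
  move=> x xS xm; rewrite inE inordK; last by lia.
  by have := amS x xS; move: xm; rewrite -val_eqE /=; lia.
have [R0|R0] := eqVneq (full_shifts B) set0.
  right; have := card_symdiff_le S (uphalfset n); have := card_uphalfset_le n.
  move: cR; rewrite R0 setC0 cardsT card_ord => cR.
  (* Now l is at most about n / 2, so a = m - l is close to n / 2, and the elements of S outside I_2
     lie between a and n / 2. *)
  suff : #|S :\: uphalfset n| <= (n %/ 2).+1 - a by lia.
  apply: (@card_leq_inj_nat _ _ (fun x : 'I_n.+1 => x - a)) => [x y|x].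
    rewrite !inE => /andP[_ /amS xS] /andP[_ /amS yS] e.
    by apply: val_inj => /=; lia.
  by rewrite !inE => /andP[xh /amS xS]; lia.
(* The slack is tau = t + 4, allowing for |B| = |S| - 1. *)
have cR' : #|~: full_shifts B| <= #|B| + (t + 4) by lia.
have bt : 25 * (t + 4) < #|B| by lia.
have lB : p.+2 <= 2 * #|B| + (t + 4) by lia.
(* Parities in B are relative to a, and B lacks m; hence the twist by [odd a] and the extra 1. *)
have par (d : bool) : #|[set x in S | odd x (+) odd a == d]| <= (t + 4).+1 \/
                      #|[set x in S | odd x (+) odd a == ~~ d]| <= (t + 4).+1.
  have := cyclic_parity cR' bt R0 lB.
  have E (P Q : pred nat) : #|[set r in B | Q r]| <= t + 4 ->
      (forall r, P (a + r) = Q r) -> #|[set x in S | P x]| <= (t + 4).+1.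
    move=> h PQ; apply: leq_trans (card_translate_sub S1 sf aS mS lE amS P) _.
    by rewrite ltnS (_ : [set r in _ | _] = [set r in B | Q r]) //;
       apply/setP => r; rewrite !inE PQ.
  have Eo (e : bool) : #|[set r in B | odd r]| <= t + 4 -> e ->
      #|[set x in S | odd x (+) odd a == e]| <= (t + 4).+1.
    move=> h e1; apply: (E (fun x => odd x (+) odd a == e) odd h) => r.
    by rewrite oddD addbAC addbb addFb e1 eqb_id.
  have Ee (e : bool) : #|[set r in B | ~~ odd r]| <= t + 4 -> ~~ e ->
      #|[set x in S | odd x (+) odd a == e]| <= (t + 4).+1.
    move=> h e1; apply: (E (fun x => odd x (+) odd a == e) (fun r => ~~ odd r) h) => r.
    by rewrite oddD addbAC addbb addFb (negbTE e1) eqbF_neg.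
  by case=> h; case: d; [left|right|right|left]; first [exact: Eo|exact: Ee].
have {par} [oS|eS] : #|[set x in S | ~~ odd x]| <= (t + 4).+1 \/
                  #|[set x in S | odd x]| <= (t + 4).+1.
- have Ee : [set x in S | ~~ odd x] = [set x in S | odd x (+) odd a == odd a].
    by apply/setP => x; rewrite !inE; case: odd; case: odd; rewrite ?andbF.
  have Eo : [set x in S | odd x] = [set x in S | odd x (+) odd a == ~~ odd a].
    by apply/setP => x; rewrite !inE; case: odd; case: odd; rewrite ?andbF.
  by rewrite Ee Eo.
- left; have := card_symdiff_le S (oddset n); have := card_oddset_le n.
  have -> : S :\: oddset n = [set x in S | ~~ odd x].
    by apply/setP => x; rewrite !inE andbC.
  by lia.
(* If S were almost all even, its size would be about n / 4 at most, against |S| close to n / 2. *)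
have : 4 * #|[set x in S | ~~ odd x]| <= n + 2.
  apply: card_even_sum_free.
  - by apply: subset_trans S1; apply/subsetP => x; rewrite inE => /andP[].
  - by apply: sum_free_sub sf; apply/subsetP => x; rewrite inE => /andP[].
  - by move=> x; rewrite inE => /andP[].
have := cardsID [set x : 'I_n.+1 | odd x] S.
have -> : S :&: [set x : 'I_n.+1 | odd x] = [set x in S | odd x].
  by apply/setP => x; rewrite !inE.
have -> : S :\: [set x : 'I_n.+1 | odd x] = [set x in S | ~~ odd x].
  by apply/setP => x; rewrite !inE andbC.
move=> cS; have : #|S| <= (t + 4).+1 + #|[set x in S | ~~ odd x]|.
  by rewrite -cS leq_add2r.
by lia.
Qed.

(** * Containers *)

Definition small_sets (T : finType) (k : nat) : {set {set T}} :=
  [set A : {set T} | #|A| <= k].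

(** Expand (M + 1)^N as the sum of M^(N - |A|) over all subsets A of an N-element set, and keep the
    terms with |A| <= k, each at least M^(N - k). *)
Lemma card_small_sets (T : finType) (k M : nat) : 0 < M ->
  #|small_sets T k| * M ^ #|T| <= M.+1 ^ #|T| * M ^ k.
Proof.
move=> M0; set N := #|T|.
have -> : M.+1 ^ N = \sum_(A : {set T}) M ^ (N - #|A|).
  rewrite -addn1 expnDn (partition_big (fun A : {set T} => inord #|A| : 'I_N.+1) predT) //=.
  apply: eq_bigr => i _; rewrite exp1n muln1 mulnC.
  have P (A : {set T}) : (inord #|A| == i) = (#|A| == i).
    by rewrite -val_eqE /= inordK // ltnS max_card.
  rewrite (eq_bigr (fun=> M ^ (N - i))); last first.
    by move=> A /eqP <-; rewrite inordK // ltnS max_card.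
  rewrite sum_nat_const mulnC -(card_draws T i); congr (_ * _).
  by apply: eq_card => A; rewrite inE -[RHS]/((inord #|A| : 'I_N.+1) == i) P.
rewrite -sum_nat_const [leqLHS]big_mkcond big_distrl /=; apply: leq_sum => A _.
rewrite inE; case: ifP => // Ak; rewrite -expnD leq_pexp2l //.
by have := max_card A; lia.
Qed.

Section Containers.
Variables n phi : nat.
Implicit Types (S T F P : {set 'I_n.+1}) (m w K : nat).

(* With [T] a subset of a sum-free set [S], [S] is independent in the graph joining
   x and y when x + y is in T.  If all of [T] lies just above [m], this graph is nearly
   regular of degree #|T| on [1, m], so a Kleitman-Winston fingerprint [F] confines
   S in [1, m] to [residual T F m], of size about m / 2; [P] collects the elements of S
   above the window containing [T]. *)
Definition nbr T (x : 'I_n.+1) : {set 'I_n.+1} := [set y : 'I_n.+1 | [exists t in T, x + y == t]].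

Definition nbrs T F : {set 'I_n.+1} := \bigcup_(f in F) nbr T f.

Definition residual T F m : {set 'I_n.+1} :=
  [set x : 'I_n.+1 | [&& 0 < x <= m, x \notin nbrs T F & #|nbr T x :\: nbrs T F| < phi]].

Definition container m w P T F : {set 'I_n.+1} :=
  P :|: [set x : 'I_n.+1 | m < x <= m + w] :|: residual T F m.

Lemma nbr_sym T x y : (y \in nbr T x) = (x \in nbr T y).
Proof. by rewrite !inE; apply: eq_existsb => t; rewrite addnC. Qed.

Lemma card_nbr_le T x : #|nbr T x| <= #|T|.
Proof.
pose f (y : 'I_n.+1) : 'I_n.+1 := inord (x + y).
have fE y : y \in nbr T x -> nat_of_ord (f y) = x + y /\ f y \in T.
  rewrite inE => /exists_inP[t tT /eqP e]; rewrite /f e.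
  by rewrite inordK // inord_val.
have finj : {in nbr T x &, injective f}.
  move=> y z /fE[yE _] /fE[zE _] /(congr1 (@nat_of_ord _)).
  by rewrite yE zE => /addnI /ord_inj.
rewrite -(card_in_imset finj).
by apply/subset_leq_card/subsetP => _ /imsetP[y /fE[_ ?] ->].
Qed.

Lemma card_nbr T (x : 'I_n.+1) m : x <= m -> (forall t, t \in T -> m < t) -> #|nbr T x| = #|T|.
Proof.
move=> xm Tm; apply/eqP; rewrite eqn_leq card_nbr_le /=.
pose f (t : 'I_n.+1) : 'I_n.+1 := inord (t - x).
have fE t : t \in T -> nat_of_ord (f t) = t - x.
  by move=> tT; rewrite inordK //; have := ltn_ord t; lia.
have finj : {in T &, injective f}.
  move=> s t sT tT /(congr1 (@nat_of_ord _)); rewrite !fE // => e.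
  by apply: ord_inj; have := Tm _ sT; have := Tm _ tT; lia.
rewrite -(card_in_imset finj).
apply/subset_leq_card/subsetP => _ /imsetP[t tT ->]; rewrite inE.
apply/exists_inP; exists t => //; rewrite fE //; apply/eqP.
by have := Tm _ tT; lia.
Qed.

(** Double count the edges between the residual set D and N = [nbrs T F]: each x in D sends at least
    |T| - phi edges into N, each y in N receives at most |T|, and |D| + |N| <= n + 1. *)
Lemma card_residual T F m : (forall t, t \in T -> m < t) -> phi <= #|T| ->
  #|residual T F m| * (2 * #|T| - phi) <= #|T| * n.+1.
Proof.
move=> Tm phiT; set D := residual T F m; set N := nbrs T F.
have DN : #|D| + #|N| <= n.+1.
  have := (leq_card_setU D N).2; have := (leq_card_setU D N).1.
  have -> : [disjoint D & N].
    by rewrite disjoint_subset; apply/subsetP => x; rewrite !inE => /and3P[].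
  by move=> _ /eqP <-; rewrite -[leqRHS]card_ord max_card.
have deg x : x \in D -> #|T| - phi <= #|nbr T x :&: N|.
  rewrite inE => /and3P[/andP[_ xm] _ /ltnW lt].
  rewrite -(card_nbr xm Tm) -(cardsID N (nbr T x)) leq_subLR addnC.
  by rewrite leq_add2r.
have h1 : #|D| * (#|T| - phi) <= \sum_(x in D) #|nbr T x :&: N|.
  by rewrite -sum_nat_const; apply: leq_sum.
have h2 : \sum_(x in D) #|nbr T x :&: N| <= #|N| * #|T|.
  rewrite (eq_bigr (fun x => \sum_(y in N) (y \in nbr T x))); last first.
    move=> x _; rewrite -sum1_card big_mkcond [RHS]big_mkcond /=.
    by apply: eq_bigr => y _; rewrite in_setI; case: (y \in nbr T x); case: (y \in N).
  rewrite exchange_big -sum_nat_const; apply: leq_sum => y _ /=.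
  apply: leq_trans _ (card_nbr_le T y); rewrite -sum1_card [leqRHS]big_mkcond.
  rewrite [leqLHS]big_mkcond /=. apply: leq_sum => x _; rewrite nbr_sym.
  by case: (x \in nbr T y); case: (x \in D).
have := leq_trans h1 h2; move: DN phiT; move: #|D| #|N| #|T| => d c k; nia.
Qed.

Lemma nbrsU1 T F x : nbrs T (x |: F) = nbr T x :|: nbrs T F.
Proof.
apply/setP => y; rewrite inE; apply/bigcupP/orP.
  by case=> f; rewrite in_setU1 => /orP[/eqP ->|fF yf]; [left|right; apply/bigcupP; exists f].
case=> [yx|/bigcupP[f fF yf]]; first by exists x => //; rewrite setU11.
by exists f => //; rewrite setU1r.
Qed.

(** Take F of maximal size among the subsets of S with at least phi |F| neighbours. A point of S
    with phi new neighbours could be added to F, and independence keeps S off the neighbours of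
    F. *)
Lemma fingerprint S T m : 0 < phi -> S \subset oneto n -> sum_free S -> T \subset S ->
  exists2 F : {set 'I_n.+1}, phi * #|F| <= n.+1 & [set x in S | x <= m] \subset residual T F m.
Proof.
move=> phi0 /subsetP S1 /sum_freeP sf /subsetP TS.
pose good F := (F \subset S) && (phi * #|F| <= #|nbrs T F|).
have good0 : good set0 by rewrite /good sub0set cards0 muln0.
have [F /andP[/subsetP FS Fphi] Fmax] := @arg_maxnP _ set0 good (fun F => #|F|) good0.
exists F; first by apply: leq_trans Fphi _; rewrite -[leqRHS]card_ord max_card.
apply/subsetP => x; rewrite inE => /andP[xS xm].
have := S1 x xS; rewrite !inE => -> /=; rewrite xm /=; apply/andP; split.
  apply/negP => /bigcupP[f fF]; rewrite inE => /exists_inP[t tT /eqP e].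
  by apply: (sf f x t) => //; [exact: FS|exact: TS].
rewrite ltnNge; apply/negP => big.
have xF : x \notin F.
  apply/negP => xF; move: big; rewrite leqNgt => /negP; apply.
  rewrite (_ : _ :\: _ = set0) ?cards0 //; apply/eqP; rewrite setD_eq0.
  by apply/subsetP => y yx; apply/bigcupP; exists x.
have : good (x |: F).
  rewrite /good; apply/andP; split.
    by apply/subsetP => y; rewrite in_setU1 => /orP[/eqP ->|/FS].
  rewrite cardsU1 xF nbrsU1 setUC.
  have := cardsID (nbrs T F) (nbrs T F :|: nbr T x).
  rewrite setIC setIUr setIid (setUidPl (subsetIl _ _)).
  by rewrite setDUl setDv set0U => <-; rewrite mulnDr muln1 addnC leq_add.
by move/Fmax; rewrite cardsU1 xF add1n; apply/negP; rewrite -ltnNge.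
Qed.

(** Scan windows of width w downwards from n and stop at the first with at least K elements of S;
    the windows above it have fewer than K each. *)
Lemma dense_window S K w q : S \subset oneto n -> n <= q * w ->
  #|S| <= q * K \/
  exists m (T : {set 'I_n.+1}), [/\ m <= n, T \subset S, #|T| = K, (forall t, t \in T -> m < t) &
                  #|[set x in S | m + w < x]| <= q * K].
Proof.
move=> /subsetP S1 nqw.
have main j : j <= q -> #|[set x in S | n < x + j * w]| <= j * K \/
  exists m (T : {set 'I_n.+1}), [/\ m <= n, T \subset S, #|T| = K, (forall t, t \in T -> m < t) &
                  #|[set x in S | m + w < x]| <= q * K].
  elim: j => [_|j IH jq].
    left; rewrite leqn0 cards_eq0; apply/eqP/setP => x; rewrite !inE.
    by rewrite addn0 ltnNge -ltnS ltn_ord andbF.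
  have [cj|] := IH (ltnW jq); last by right.
  pose m := n - j.+1 * w.
  pose W := [set x in S | (n < x + j.+1 * w) && ~~ (n < x + j * w)].
  have [WK|WK] := ltnP #|W| K.
    left; rewrite -(cardsID [set x : 'I_n.+1 | n < x + j * w]) [leqRHS]mulSnr.
    apply: leq_add; last first.
      apply: leq_trans _ (ltnW WK); apply/subset_leq_card/subsetP => x.
      by rewrite !inE => /andP[-> /andP[-> ->]].
    apply: leq_trans _ cj; apply/subset_leq_card/subsetP => x.
    by rewrite !inE => /andP[/andP[-> _] ->].
  right; have [T TW cT] : exists2 T : {set 'I_n.+1}, T \subset W & #|T| = K.
    exists [set x in take K (enum W)].
      by apply/subsetP => x; rewrite inE => /mem_take; rewrite mem_enum.
    have u : uniq (take K (enum W)) by rewrite take_uniq // enum_uniq.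
    by rewrite cardsE (card_uniqP u) size_take -cardE; case: ltngtP WK.
  exists m, T; split=> //.
  - exact: leq_subr.
  - by apply: subset_trans TW _; apply/subsetP => x; rewrite inE => /andP[].
  - move=> t /(subsetP TW); rewrite inE => /andP[tS /andP[nt _]].
    by have := S1 t tS; rewrite inE /m; lia.
  apply: leq_trans (_ : j * K <= _); last by rewrite leq_mul2r (ltnW jq) orbT.
  apply: leq_trans _ cj; apply/subset_leq_card/subsetP => x; rewrite !inE /m.
  by case/andP=> -> /=; rewrite mulSn; lia.
have [cS|] := main q (leqnn q); last by right.
left; apply: leq_trans _ cS; apply/subset_leq_card/subsetP => x xS.
by have := S1 x xS; rewrite !inE xS /=; lia.
Qed.

Lemma sum_free_containers K w q k b : 0 < phi <= K -> n <= q * w -> q * K <= k -> K <= k ->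
  n.+1 < phi * k.+1 ->
  (forall d, d * (2 * K - phi) <= K * n.+1 -> k + w + d <= b) ->
  exists CF : {set {set 'I_n.+1}},
    [/\ #|CF| <= n.+1 * #|small_sets 'I_n.+1 k| ^ 3,
        (forall C, C \in CF -> #|C| <= b) &
        forall S : {set 'I_n.+1}, S \subset oneto n -> sum_free S -> exists2 C, C \in CF & S \subset C].
Proof.
move=> /andP[phi0 phiK] nqw qKk Kk nphi db.
pose Q := small_sets 'I_n.+1 k.
pose codes := setX [set: 'I_n.+1] (setX Q (setX Q Q)).
pose C (c : 'I_n.+1 * ({set 'I_n.+1} * ({set 'I_n.+1} * {set 'I_n.+1}))) :=
  container c.1 w c.2.1 c.2.2.1 c.2.2.2.
(* An arbitrary code may give a large set, so the family is filtered by size; codes coming from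
   sum-free sets pass the filter. *)
exists [set X in C @: codes | #|X| <= b]; split.
- apply: leq_trans (_ : #|C @: codes| <= _).
    by apply/subset_leq_card/subsetP => X; rewrite inE => /andP[].
  apply: leq_trans (leq_imset_card _ _) _.
  by rewrite !cardsX cardsT card_ord /Q expnS expnS expn1.
- by move=> X; rewrite inE => /andP[].
move=> S S1 sf.
have cW m : #|[set x : 'I_n.+1 | m < x <= m + w]| <= w.
  apply: (@card_leq_inj_nat _ _ (fun x : 'I_n.+1 => x - m.+1)) => [x y|x].
    by rewrite !inE => ox oy e; apply: ord_inj; lia.
  by rewrite inE; lia.
have cC m P T F : #|P| <= k -> #|residual T F m| * (2 * K - phi) <= K * n.+1 ->
    #|container m w P T F| <= b.
  move=> Pk /db; apply: leq_trans.
  apply: leq_trans (leq_card_setU _ _).1 _; rewrite leq_add2r.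
  by apply: leq_trans (leq_card_setU _ _).1 _; rewrite leq_add.
have sub m P T F : [set x in S | m + w < x] \subset P ->
    [set x in S | x <= m] \subset residual T F m -> S \subset container m w P T F.
  move=> /subsetP h1 /subsetP h2; apply/subsetP => x xS; rewrite 2!inE.
  have [xm|mx] := leqP x m; first by rewrite (h2 x) ?orbT // inE xS.
  have [xw|wx] := ltnP (m + w) x; first by rewrite (h1 x) // inE xS.
  by rewrite [in X in _ || X || _]inE mx wx orbT.
have mem m P T F (mn : m < n.+1) : #|P| <= k -> #|T| <= k -> #|F| <= k ->
    container m w P T F \in C @: codes.
  move=> Pk Tk Fk; apply/imsetP; exists (Ordinal mn, (P, (T, F))) => //.
  by rewrite !inE /= Pk Tk Fk.
have [Sk|[m [T [mn TS cT Tm Pk]]]] := @dense_window S K w q S1 nqw.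
  (* If no window is dense, S itself is small and serves as P, with m = 0 and an empty residual
     part. *)
  have r0 : residual set0 set0 0 = set0.
    by apply/setP => x; rewrite !inE; case: (nat_of_ord x).
  exists (container 0 w S set0 set0).
    by rewrite inE mem ?cards0 // ?cC ?r0 ?cards0 // (leq_trans Sk qKk).
  apply: sub; first by apply/subsetP => x; rewrite inE => /andP[].
  apply/subsetP => x; rewrite inE => /andP[/(subsetP S1)].
  by rewrite inE lt0n => /negbTE x0; rewrite leqn0 x0.
have [F cF SF] := @fingerprint S T m phi0 S1 sf TS.
exists (container m w [set x in S | m + w < x] T F); last exact: sub.
rewrite inE mem ?cT ?(leq_trans Pk) //; last by rewrite -ltnS -(ltn_pmul2l phi0) (leq_ltn_trans cF).
apply: cC; first exact: leq_trans Pk qKk.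
by rewrite -cT; apply: card_residual => //; rewrite cT.
Qed.

End Containers.

(** Here k is about n / M^2 and b is about n / 2 + 4 n / M, so a large M gives 2^{o(n)} containers
    of size (1/2 + o(1)) n. *)
Lemma sum_free_containers_param n M : 1 < M -> M ^ 7 <= n ->
  exists k b (CF : {set {set 'I_n.+1}}),
    [/\ k * M ^ 2 <= n.+1, b * (2 * M) <= (M + 8) * n,
        #|CF| <= #|small_sets 'I_n.+1 k| ^ 4,
        (forall C, C \in CF -> #|C| <= b) &
        forall S : {set 'I_n.+1}, S \subset oneto n -> sum_free S ->
          exists2 C, C \in CF & S \subset C].
Proof.
move=> M1 Mn; have M0 := ltnW M1.
(* The parameters of [sum_free_containers] are phi = M^2, K = M^4, q = M. *)
pose k := n.+1 %/ M ^ 2; pose w := (n %/ M).+1; pose b := ((M + 8) * n) %/ (2 * M).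
have MM0 : 0 < M ^ 2 by rewrite expn_gt0 M0.
have kM : k * M ^ 2 <= n.+1 by exact: leq_divM.
(* This uses n >= M^7, and gives q * K = M^5 <= k. *)
have M5k : M ^ 5 <= k by rewrite leq_divRL // -expnD (leq_trans Mn).
have wn : n <= M * w by rewrite mulnC ltnW // ltn_ceil.
have wM : w * M <= n + M by rewrite mulSn addnC leq_add2r leq_divM.
have Mlen : M <= n by apply: leq_trans Mn; rewrite -{1}(expn1 M) leq_pexp2l.
have db d : d * (2 * M ^ 4 - M ^ 2) <= M ^ 4 * n.+1 -> k + w + d <= b.
  have -> : M ^ 4 = M ^ 2 * M ^ 2 by rewrite -expnD.
  move=> h; have {h} : d * (2 * M ^ 2 - 1) <= M ^ 2 * n.+1.
    rewrite -(leq_pmul2r MM0); move: h; move: (M ^ 2) => m h.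
    have e : (2 * m - 1) * m = 2 * (m * m) - m by rewrite mulnBl mul1n mulnA.
    by rewrite -[leqLHS]mulnA e [leqRHS]mulnAC.
  move: kM wM Mlen; rewrite /b leq_divRL ?muln_gt0 ?M0 //.
  rewrite -mulnn; move: M0 M1; clearbody k w; clear => M0 M1 kM wM Mn dM.
  have h1 : k * M <= n.
    rewrite -(leq_pmul2r M0) -mulnA; apply: leq_trans kM _; nia.
  have dn : d <= n.+1.
    rewrite -(@leq_pmul2r (2 * (M * M) - 1)); last by nia.
    by apply: leq_trans dM _; nia.
  have h2 : M * (2 * M * d) <= M * (M * n.+1) + n.+1 by nia.
  have h3 : 2 * M * d <= M * n.+1 + n.
    rewrite -(leq_pmul2l M0); apply: leq_trans h2 _; nia.
  nia.
have phiK : 0 < M ^ 2 <= M ^ 4 by rewrite MM0 leq_pexp2l.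
have nk : n.+1 < M ^ 2 * k.+1 by rewrite mulnC ltn_ceil.
have qK : M * M ^ 4 <= k by rewrite -expnS.
have Kk : M ^ 4 <= k by apply: leq_trans M5k; rewrite leq_pexp2l.
have [CF [cCF CFb CFcov]] := sum_free_containers phiK wn qK Kk nk db.
exists k, b, CF; split=> //; first exact: leq_divM.
(* The factor n + 1 is absorbed into a fourth power, since singletons are small sets. *)
apply: leq_trans cCF _; rewrite [leqRHS]expnS leq_mul2r; apply/orP; right.
have inj : injective (fun x : 'I_n.+1 => [set x]) by exact: set1_inj.
rewrite -{1}(card_ord n.+1) -(card_imset _ inj).
apply/subset_leq_card/subsetP => _ /imsetP[x _ ->].
by rewrite inE cards1 (leq_trans _ M5k) // expn_gt0 M0.
Qed.

(** * Counting colourings *)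

Section Colourings.
Variable n : nat.
Implicit Types (A C T : {set 'I_n.+1}) (s : {ffun 'I_n.+1 -> 'I_3}).

(* Colourings of [A] are extended by the colour [0] outside [A], so that all of
   them live in the same type. *)
Definition valid_ext A : {set {ffun 'I_n.+1 -> 'I_3}} :=
  [set s in pfamily ord0 (mem A) (fun=> predT) |
     [forall c, sum_free [set x in A | s x == c]]].

Lemma card_pfamily_prod A (F : 'I_n.+1 -> pred 'I_3) :
  #|pfamily (ord0 : 'I_3) (mem A) F| = \prod_(x in A) #|F x|.
Proof. by rewrite card_pfamily foldrE big_image. Qed.

Lemma card_pfamily_pred A (F : 'I_n.+1 -> pred 'I_3) :
  (forall x, #|F x| = 3) -> #|pfamily (ord0 : 'I_3) (mem A) F| = 3 ^ #|A|.
Proof.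
move=> F3; rewrite card_pfamily_prod (eq_bigr (fun=> 3)) // prod_nat_const //.
Qed.

Definition extend A (s : colouring A 3) : {ffun 'I_n.+1 -> 'I_3} :=
  [ffun x => if insub x is Some u then s u else ord0].

Lemma extend_val A (s : colouring A 3) u : extend s (val u) = s u.
Proof. by rewrite ffunE valK. Qed.

Lemma nvalid_le_ext A : nvalid A 3 <= #|valid_ext A|.
Proof.
have inj : injective (@extend A).
  move=> s t e; apply/ffunP => u.
  by rewrite -!extend_val e.
rewrite /nvalid -(card_imset _ inj); apply/subset_leq_card/subsetP => _ /imsetP[s + ->].
rewrite !inE => /forallP sv; apply/andP; split.
  apply/pfamilyP; split=> //; apply/subsetP => x; rewrite !inE ffunE.
  by case: insubP => [u -> //|]; rewrite eqxx.
apply/forallP => c; have := sv c; congr (is_true (sum_free _)).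
apply/setP => x; rewrite !inE; apply/imsetP/andP.
  case=> u; rewrite inE => su ->; split; first exact: valP.
  by rewrite extend_val.
case=> xA sx; exists (Sub x xA : {x | x \in A}); last by rewrite SubK.
by rewrite inE -extend_val SubK.
Qed.

Lemma nvalid_sum_free A : sum_free A -> nvalid A 3 = 3 ^ #|A|.
Proof.
move=> sf; rewrite /nvalid.
have -> : [set s : colouring A 3 | valid s] = setT.
  apply/setP => s; rewrite !inE; apply/forallP => c.
  by apply: sum_free_sub sf; apply/subsetP => _ /imsetP[u _ ->]; exact: valP.
by rewrite cardsT card_ffun card_ord card_sig.
Qed.

(** Every 3-colouring of the odd numbers is valid; squaring avoids the fraction n / 2. *)
Lemma max_nvalid_ge : 3 ^ n <= max_nvalid n 3 ^ 2.
Proof.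
have sf : sum_free (oddset n).
  apply/sum_freeP => x y z; rewrite !inE => ox oy oz e.
  by move: oz; rewrite -e oddD ox oy.
have sub : oddset n \subset oneto n.
  by apply/subsetP => x; rewrite !inE; case: (nat_of_ord x).
have h : nvalid (oddset n) 3 <= max_nvalid n 3 by apply: leq_bigmax_cond.
apply: leq_trans (_ : (3 ^ #|oddset n|) ^ 2 <= _); last first.
  by rewrite leq_exp2r // -nvalid_sum_free.
by rewrite -expnM leq_exp2l // mulnC card_oddset_ge.
Qed.

Section ContainerCount.
Variables (CF : {set {set 'I_n.+1}}) (b : nat) (A : {set 'I_n.+1}).
Hypothesis CFb : forall C, C \in CF -> #|C| <= b.
Hypothesis CFcover : forall S : {set 'I_n.+1}, S \subset oneto n -> sum_free S ->
  exists2 C, C \in CF & S \subset C.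

Local Notation palette t x := [pred c : 'I_3 | x \in (t : {ffun 'I_3 -> {set 'I_n.+1}}) c].

(* The factor (8/9) to spare when p < 3 is what forces p = 3 almost everywhere. *)
Let palette_bound (p : nat) : p <= 3 -> p ^ 3 * 9 ^ (p != 3) <= 3 ^ p * 8 ^ (p != 3).
Proof. by case: p => [|[|[|[|]]]]. Qed.

(** The number of compatible colourings is the product of the palette sizes p(x). Cubing makes p^3
    <= 3^p usable, and the p(x) sum to at most 3b. *)
Lemma card_palettes (t : {ffun 'I_3 -> {set 'I_n.+1}}) : t \in ffun_on (mem CF) ->
  #|pfamily (ord0 : 'I_3) (mem A) (fun x => palette t x)| ^ 3 * 9 ^ (#|A| - b)
    <= 3 ^ (3 * b) * 8 ^ (#|A| - b).
Proof.
move=> /ffun_onP tCF; rewrite card_pfamily_prod.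
pose p x := #|palette t x|; pose w := \sum_(x in A) (p x != 3).
have h1 : (\prod_(x in A) p x) ^ 3 * 9 ^ w <= 3 ^ (\sum_(x in A) p x) * 8 ^ w.
  rewrite /w !expn_sum (big_morph (expn^~ 3) (fun a c => expnMn a c 3) (exp1n 3)) -!big_split /=; apply: leq_prod => x _.
  by apply: palette_bound; rewrite -[leqRHS](card_ord 3) max_card.
have h2 : \sum_(x in A) p x <= 3 * b.
  apply: leq_trans (_ : \sum_(x in A) \sum_(c < 3) (x \in t c) <= _).
    apply: leq_sum => x _; rewrite /p -sum1_card big_mkcond /=.
    by apply: leq_sum => c _; rewrite inE; case: ifP.
  rewrite exchange_big /= -[X in X * b](card_ord 3) -sum_nat_const.
  apply: leq_sum => c _; apply: leq_trans (CFb (tCF c)).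
  rewrite -sum1_card big_mkcond [leqRHS]big_mkcond; apply: leq_sum => x _ /=.
  by case: (x \in A); case: (x \in t c).
(* A point of A outside the container of colour 0 has p < 3, and at most b points lie inside it. *)
have h3 : #|A| - b <= w.
  rewrite leq_subLR; apply: leq_trans (_ : #|t ord0| + w <= _); last first.
    by rewrite leq_add2r; apply: CFb.
  rewrite /w -!sum1_card [X in X <= _]big_mkcond [X in _ <= X + _]big_mkcond.
  rewrite [X in _ <= _ + X]big_mkcond -big_split; apply: leq_sum => x _ /=.
  case: (x \in A) => //; case: ifP => [//|xt]; rewrite add0n lt0b.
  rewrite neq_ltn /p; apply/orP; left; rewrite -[X in _ < X](card_ord 3).
  by apply: proper_card; apply/properP; split; [exact: subset_predT|exists ord0; rewrite // inE xt].
have h4 : 3 ^ (\sum_(x in A) p x) <= 3 ^ (3 * b) by rewrite leq_exp2l.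
have {}h1 := leq_trans h1 (leq_mul h4 (leqnn (8 ^ w))).
move: h1; rewrite -(subnK h3) !expnD.
set d := w - _; set e := #|A| - b.
have d98 : 8 ^ d <= 9 ^ d by case: d => // d; rewrite leq_exp2r.
have : 0 < 8 ^ d by rewrite expn_gt0.
rewrite -[\prod_(x in A) #|_|]/(\prod_(x in A) p x).
move: (_ ^ 3) (3 ^ _) (8 ^ d) (9 ^ d) (8 ^ e) (9 ^ e) d98 => P X a c a' c'.
by nia.
Qed.

(** Each valid colouring is compatible with one of the |CF|^3 triples of containers; cubing gives
    the exponent 9. *)
Lemma card_valid_ext_containers : A \subset oneto n ->
  #|valid_ext A| ^ 3 * 9 ^ (#|A| - b) <= #|CF| ^ 9 * (3 ^ (3 * b) * 8 ^ (#|A| - b)).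
Proof.
move=> A1; pose Z t := #|pfamily (ord0 : 'I_3) (mem A) (fun x => palette t x)|.
pose M := \max_(t in ffun_on (mem CF)) Z t.
have hM : M ^ 3 * 9 ^ (#|A| - b) <= 3 ^ (3 * b) * 8 ^ (#|A| - b).
  rewrite /M; elim/big_ind: _ => [|x y hx hy|t tCF]; first by rewrite mul0n.
    by rewrite /maxn; case: ifP.
  exact: card_palettes.
have hV : #|valid_ext A| <= #|CF| ^ 3 * M.
  apply: leq_trans (_ : \sum_(t in ffun_on (mem CF)) Z t <= _).
    rewrite -sum1_card (eq_bigr (fun t => \sum_(s | s \in pfamily ord0 (mem A) (fun x => palette t x)) 1)).
      rewrite [leqLHS]big_mkcond (exchange_big_dep predT) //=; apply: leq_sum => s _.
      case: ifP => // sV.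
      have [t tCF ts] : exists2 t : {ffun 'I_3 -> {set 'I_n.+1}}, t \in ffun_on (mem CF) &
          s \in pfamily ord0 (mem A) (fun x => palette t x).
        move: sV; rewrite inE => /andP[/pfamilyP[sA _] /forallP sv].
        have ex c : exists C, (C \in CF) && ([set x in A | s x == c] \subset C).
          have [|C CCF sC] := CFcover _ (sv c); last by exists C; rewrite CCF.
          by apply: subset_trans A1; apply/subsetP => x; rewrite inE => /andP[].
        exists [ffun c => xchoose (ex c)].
          by apply/ffun_onP => c; rewrite ffunE; have /andP[] := xchooseP (ex c).
        apply/pfamilyP; split=> // x xA; rewrite inE ffunE.
        have /andP[_ /subsetP] := xchooseP (ex (s x)); apply.
        by rewrite inE eqxx andbT.
      by rewrite (bigD1 t) ?tCF ?ts //= ltnS leq0n.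
    by move=> t _; rewrite sum1_card.
  have <- : #|[pred t : {ffun 'I_3 -> {set 'I_n.+1}} | t \in ffun_on (mem CF)]| = #|CF| ^ 3.
    by rewrite -[3 in RHS]card_ord -card_ffun_on; apply: eq_card.
  by rewrite -sum_nat_const; apply: leq_sum => t tCF; apply: leq_bigmax_cond.
apply: leq_trans (_ : (#|CF| ^ 3 * M) ^ 3 * 9 ^ (#|A| - b) <= _).
  by rewrite leq_mul2r leq_exp2r // hV orbT.
by rewrite expnMn -expnM -mulnA leq_mul2l hM orbT.
Qed.

End ContainerCount.

Lemma valid_extP A s : s \in valid_ext A ->
  (forall x, x \notin A -> s x = ord0) /\ (forall c, sum_free [set x in A | s x == c]).
Proof.
rewrite inE => /andP[/pfamilyP[/subsetP sA _] /forallP sv]; split=> // x xA.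
by apply/eqP; apply: contraNT xA => sx; apply: sA.
Qed.

Lemma valid_extI A s : (forall x, x \notin A -> s x = ord0) ->
  (forall c, sum_free [set x in A | s x == c]) -> s \in valid_ext A.
Proof.
move=> s0 sv; rewrite inE; apply/andP; split; last exact/forallP.
apply/pfamilyP; split=> //; apply/subsetP => x; apply: contraNT => xA.
by apply/eqP/s0.
Qed.

Definition restrict_to T s : {ffun 'I_n.+1 -> 'I_3} := [ffun x => if x \in T then s x else ord0].

Lemma restrict_valid A T s : T \subset A -> s \in valid_ext A -> restrict_to T s \in valid_ext T.
Proof.
move=> /subsetP TA /valid_extP[_ sv]; apply: valid_extI => [x /negbTE xT|c].
  by rewrite ffunE xT.
apply: sum_free_sub (sv c); apply/subsetP => x; rewrite !inE ffunE.
by case/andP => xT; rewrite xT TA.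
Qed.

Lemma card_valid_extD A T : T \subset A ->
  #|valid_ext A| <= #|valid_ext (A :\: T)| * #|valid_ext T|.
Proof.
move=> TA; pose g s := (restrict_to (A :\: T) s, restrict_to T s).
have ginj : {in valid_ext A &, injective g}.
  move=> s t /valid_extP[s0 _] /valid_extP[t0 _] [/ffunP e1 /ffunP e2].
  apply/ffunP => x; have := e1 x; have := e2 x; rewrite !ffunE inE.
  have [//|_ _] := boolP (x \in T).
  by have [//|xA _] := boolP (x \in A); rewrite s0 ?t0.
rewrite -cardsX -(card_in_imset ginj).
apply/subset_leq_card/subsetP => _ /imsetP[s sV ->].
by rewrite inE !(restrict_valid _ sV) // subsetDl.
Qed.

Lemma card_valid_ext_le A : #|valid_ext A| <= 3 ^ #|A|.
Proof.
rewrite -(@card_pfamily_pred A (fun=> predT)) => [|x]; last by rewrite card_ord.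
by apply/subset_leq_card/subsetP => s; rewrite inE => /andP[].
Qed.

(* The three constant colourings of a Schur triple are invalid. *)
Lemma card_valid_ext_triple (x y z : 'I_n.+1) : x + y = z :> nat ->
  #|valid_ext [set x; y; z]| * 9 <= 3 ^ #|[set x; y; z]| * 8.
Proof.
move=> xyz; set T := [set x; y; z].
have cT : #|T| <= 3.
  rewrite /T; apply: leq_trans (leq_card_setU _ _).1 _.
  by rewrite cards1 cards2; case: eqP.
pose k (c : 'I_3) := restrict_to T [ffun=> c].
have xT : x \in T by rewrite !inE eqxx.
have yT : y \in T by rewrite !inE eqxx orbT.
have zT : z \in T by rewrite !inE eqxx orbT.
have kinj : injective k.
  by move=> c d /ffunP/(_ x); rewrite !ffunE xT.
have dis : valid_ext T :&: [set k c | c : 'I_3] = set0.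
  apply/setP => s; rewrite in_setI in_set0; apply/negP => /andP[/valid_extP[_ sv]].
  case/imsetP => c _ sk; apply: (sum_freeP _ (sv c) x y z) => //;
    by rewrite inE sk !ffunE ?xT ?yT ?zT eqxx.
have := cardsUI (valid_ext T) [set k c | c : 'I_3].
rewrite dis cards0 addn0 (card_imset _ kinj) card_ord => e.
have : #|valid_ext T :|: [set k c | c : 'I_3]| <= 3 ^ #|T|.
  rewrite -(@card_pfamily_pred T (fun=> predT)) => [|?]; last by rewrite card_ord.
  apply/subset_leq_card/subsetP => s; rewrite in_setU => /orP[|/imsetP[c _ ->]].
    by rewrite inE => /andP[].
  apply/pfamilyP; split=> //.
  by apply/subsetP => u; rewrite !inE ffunE !inE; case: ifP; rewrite ?eqxx.
(* With q = 3^|T|, the bound q - 3 <= 8 q / 9 amounts to q <= 27. *)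
rewrite e; have : 3 ^ #|T| <= 3 ^ 3 by rewrite leq_exp2l.
by move: #|valid_ext T| (3 ^ #|T|) => v q; lia.
Qed.

(** Remove Schur triples greedily. Either a sum-free set is left before k triples are gone, or k
    disjoint triples each cost a factor 8/9. *)
Lemma disjoint_triples k A :
  (exists C, [/\ C \subset A, sum_free C & #|A :\: C| <= 3 * k]) \/
  #|valid_ext A| * 9 ^ k <= 3 ^ #|A| * 8 ^ k.
Proof.
elim: k A => [|k IH] A; first by right; rewrite !muln1 card_valid_ext_le.
have [sf|] := boolP (sum_free A).
  by left; exists A; rewrite subxx setDv cards0.
rewrite {1}/sum_free negb_forall_in => /exists_inP[x xA].
rewrite negb_forall_in => /exists_inP[y yA].
rewrite negb_forall_in => /exists_inP[z zA]; rewrite negbK => /eqP xyz.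
pose T := [set x; y; z].
have TA : T \subset A by rewrite !subUset !sub1set xA yA zA.
have cT : #|T| <= 3.
  rewrite /T; apply: leq_trans (leq_card_setU _ _).1 _.
  by rewrite cards1 cards2; case: eqP.
have cA : #|A| = #|A :\: T| + #|T| by rewrite -(cardsID T A) (setIidPr TA) addnC.
have [[C [CA sf cC]]|h] := IH (A :\: T).
  left; exists C; split=> //; first by apply: subset_trans CA (subsetDl _ _).
  apply: leq_trans (_ : #|(A :\: T :\: C) :|: T| <= _).
    apply/subset_leq_card/subsetP => u; rewrite in_setU !in_setD => /andP[-> ->].
    by case: (u \in T).
  by apply: leq_trans (leq_card_setU _ _).1 _; rewrite mulnS addnC leq_add.
right; apply: leq_trans (_ : #|valid_ext (A :\: T)| * #|valid_ext T| * 9 ^ k.+1 <= _).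
  by rewrite leq_mul2r card_valid_extD ?orbT.
rewrite cA expnD !expnSr mulnACA [leqRHS]mulnACA.
by apply: leq_mul => //; exact: card_valid_ext_triple.
Qed.

End Colourings.

From mathcomp Require Import all_classical all_reals all_analysis.

Import Order.TTheory GRing.Theory Num.Theory.
Import numFieldNormedType.Exports.

Local Open Scope classical_set_scope.
Local Open Scope ring_scope.

(** * Asymptotics *)

Section Asymptotics.
Variable R : realType.

Lemma ler_ln_nat (k l : nat) : (0 < k <= l)%N -> ln (k%:R : R) <= ln (l%:R : R).
Proof.
case/andP=> k0 kl; rewrite ler_ln ?ler_nat ?posrE ?ltr0n //.
exact: leq_trans kl.
Qed.

Lemma lnM_nat (k l : nat) : (0 < k)%N -> (0 < l)%N ->
  ln ((k * l)%N%:R : R) = ln k%:R + ln l%:R.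
Proof. by move=> k0 l0; rewrite natrM lnM ?posrE ?ltr0n. Qed.

Lemma lnX_nat (k m : nat) : (0 < k)%N -> ln ((k ^ m)%N%:R : R) = m%:R * ln k%:R.
Proof. by move=> k0; rewrite natrX lnXn ?ltr0n // mulr_natl. Qed.

Lemma ln3_bounds : 2 / 3 <= ln (3 : R) <= 2.
Proof.
have h := @le_ln1Dx R 2; have h' := @le_ln1Dx R (- (2 / 3)).
have e : ln (1 + - (2 / 3) : R) = - ln 3.
  by rewrite -lnV ?posrE //; congr ln; field.
rewrite e in h'; have -> : (3 : R) = 1 + 2 by ring.
by apply/andP; split; [have := h' _; rewrite (_ : 1 + 2 = 3 :> R); [lra|ring]|apply: h; lra].
Qed.

Lemma ln2_bounds : 0 <= ln (2 : R) <= 1.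
Proof.
rewrite ln_ge0 ?ler1n //=; have := @le_ln1Dx R 1.
by rewrite (_ : 1 + 1 = 2 :> R) //; apply; lra.
Qed.

Lemma ln98_bound : 1 / 9 <= ln (9 : R) - ln (8 : R).
Proof.
rewrite -ln_div ?posrE //; have := @le_ln1Dx R (- (1 / 9)).
have -> : 1 + - (1 / 9) = (9 / 8)^-1 :> R by field.
rewrite lnV ?posrE //; lra.
Qed.

(** Take logarithms in [card_small_sets], with ln (1 + 1 / M) <= 1 / M and ln M <= M. For k near |T|
    / M^2 both terms are of order |T| / M. *)
Lemma ln_card_small_sets (T : finType) (k M : nat) : (0 < M)%N ->
  ln (#|small_sets T k|%:R : R) <= #|T|%:R / M%:R + k%:R * M%:R.
Proof.
move=> M0; have M0' : 0 < M%:R :> R by rewrite ltr0n.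
have s0 : (0 < #|small_sets T k|)%N.
  by apply/card_gt0P; exists finset.set0; rewrite inE cards0.
have := card_small_sets T k M0 => h.
have {h} := ler_ln_nat (introT andP (conj _ h)).
rewrite muln_gt0 s0 expn_gt0 M0 => /(_ isT).
rewrite !lnM_nat ?expn_gt0 ?M0 ?s0 // !lnX_nat //.
have l1 : ln (M.+1%:R : R) <= ln M%:R + 1 / M%:R.
  have -> : M.+1%:R = M%:R * (1 + 1 / M%:R) :> R.
    by rewrite mulrDr mulr1 mulrCA divff ?mulr1 ?gt_eqF // -natr1.
  have p : 0 < 1 / M%:R :> R by rewrite divr_gt0.
  have q : 0 < 1 + 1 / M%:R :> R by rewrite addr_gt0.
  rewrite lnM ?posrE ?posrE //.
  by rewrite lerD2l le_ln1Dx //; lra.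
have l2 : ln (M%:R : R) <= M%:R by rewrite ltW // ln_sublinear.
have := ler_wpM2l (ler0n R #|T|) l1; have := ler_wpM2l (ler0n R k) l2.
rewrite mulrDr mulrA mulr1; lra.
Qed.

Lemma ln_valid_ext_le (eta : R) : 0 < eta -> exists n0 : nat,
  forall (n : nat) (A : {set 'I_n.+1}), (n0 <= n)%N -> A \subset oneto n ->
    (0 < #|valid_ext A|)%N ->
    3 * ln (#|valid_ext A|%:R : R) + (#|A|%:R - n%:R / 2) / 9
      <= 3 / 2 * n%:R * ln 3 + eta * n%:R.
Proof.
(* With x = n / M, the errors are 9 * 16 x from the number of containers, 12 x ln 3 <= 24 x from b
   in the main term, and 4 x / 9 from b in the correction: below 170 x in all. *)
move=> eta0; pose M := (Num.bound (170 / eta)).+2.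
have Mb : 170 / eta < M%:R.
  apply: lt_trans (archi_boundP _) _; first by rewrite divr_ge0 ?ler0n // ltW.
  by rewrite ltr_nat.
have M0 : 0 < M%:R :> R by rewrite ltr0n.
exists (M ^ 7)%N => n A Mn A1 V0.
have [k [b [CF [kM bM cCF CFb CFcov]]]] := @sum_free_containers_param n M isT Mn.
have [x xE] : exists x : R, x = n%:R / M%:R by exists (n%:R / M%:R).
have x0 : 0 <= x by rewrite xE divr_ge0.
have xeta : 170 * x <= eta * n%:R.
  rewrite xE mulrA ler_pdivrMr // mulrAC ler_wpM2r //.
  by move: Mb; rewrite ltr_pdivrMr // mulrC => /ltW.
have n1 : (0 < n)%N by apply: leq_trans Mn; rewrite expn_gt0.
have nM1 : n.+1%:R / M%:R <= 2 * x :> R.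
  rewrite xE mulrA; apply: ler_wpM2r; first by rewrite invr_ge0.
  by rewrite -natrM ler_nat; lia.
have kx : k%:R * M%:R <= 2 * x :> R.
  apply: le_trans nM1; rewrite ler_pdivlMr // -mulrA -expr2 -natrX -natrM ler_nat //.
have bx : b%:R <= n%:R / 2 + 4 * x :> R.
  have : b%:R * (2 * M%:R) <= (M%:R + 8) * n%:R :> R.
    by rewrite -natrM -natrD -!natrM ler_nat.
  rewrite -ler_pdivlMr; last by rewrite mulr_gt0.
  move=> h; apply: le_trans h _; rewrite le_eqVlt; apply/orP; left; apply/eqP; rewrite xE; field.
  by rewrite gt_eqF.
have key := card_valid_ext_containers CFb CFcov A1.
have CF0 : (0 < #|CF|)%N.
  rewrite lt0n; apply: contraTneq key => ->; rewrite exp0n // mul0n -ltnNge.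
  by rewrite muln_gt0 !expn_gt0 V0.
have lCF : ln (#|CF|%:R : R) <= 16 * x.
  have := ler_ln_nat (introT andP (conj CF0 cCF)).
  have s0 : (0 < #|small_sets 'I_n.+1 k|)%N.
    by apply/card_gt0P; exists finset.set0; rewrite inE cards0.
  rewrite lnX_nat //; have := @ln_card_small_sets 'I_n.+1 k M isT.
  rewrite card_ord; lra.
set u := (#|A| - b)%N in key.
have {key} := ler_ln_nat (introT andP (conj _ key)).
rewrite muln_gt0 !expn_gt0 V0 => /(_ isT).
rewrite !lnM_nat ?muln_gt0 ?expn_gt0 ?V0 ?CF0 // !lnX_nat // natrM.
have u1 : #|A|%:R - b%:R <= u%:R :> R.
  by rewrite lerBlDr -natrD ler_nat addnC -leq_subLR.
have := ler_wpM2l (ler0n R u) ln98_bound.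
have /andP[l3 l3'] := ln3_bounds.
have : b%:R * ln 3 <= (n%:R / 2 + 4 * x) * ln 3 :> R.
  by rewrite ler_wpM2r //; lra.
have : x * ln 3 <= x * 2 :> R by rewrite ler_wpM2l.
move: (ln 3) (ln 8) (ln 9) => L3 L8 L9 h1 h2 h3.
set y := n%:R * L3.
rewrite -[3 / 2 * n%:R * L3]mulrA -/y mulrDl mulrAC -/y in h2 *.
rewrite mulrBr in h3.
nra.
Qed.

End Asymptotics.

Lemma card_symdiff_trans (T : finType) (A C X : {set T}) : C \subset A ->
  (#|symdiff A X| <= #|A :\: C| + #|symdiff C X|)%N.
Proof.
move=> CA; apply: leq_trans (finset.leq_card_setU _ _).1.
apply/subset_leq_card/fintype.subsetP => x.
rewrite !finset.in_setU !finset.in_setD.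
by have := fintype.subsetP CA x; case: (x \in C) => [->|_] //; case: (x \in A); case: (x \in X).
Qed.

Lemma max_nvalid_attained n r : exists2 A : {set 'I_n.+1},
  A \subset oneto n & max_nvalid n r = nvalid A r.
Proof.
have h : (0 < #|[pred A : {set 'I_n.+1} | A \subset oneto n]|)%N.
  by apply/card_gt0P; exists finset.set0; rewrite inE finset.sub0set.
have [A A1 e] := eq_bigmax_cond (fun A : {set 'I_n.+1} => nvalid A r) h.
by exists A.
Qed.

Lemma max_nvalid_gt0 n : (0 < max_nvalid n 3)%N.
Proof. by have := max_nvalid_ge n; case: max_nvalid => //; rewrite leqNgt expn_gt0. Qed.

(** * Growth rate and structure of near-extremal sets *)

Section Main.
Variable R : realType.

Lemma ln_max_nvalid_ge n : n%:R / 2 * ln 3 <= ln ((max_nvalid n 3)%:R : R).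
Proof.
have := @ler_ln_nat R _ _ (introT andP (conj _ (max_nvalid_ge n))).
rewrite expn_gt0 => /(_ isT); rewrite !lnX_nat ?max_nvalid_gt0 //; lra.
Qed.

Lemma ln_max_nvalid_le (eta : R) : 0 < eta -> exists n0 : nat, forall n : nat,
  (n0 <= n)%N -> ln ((max_nvalid n 3)%:R : R) <= n%:R / 2 * ln 3 + eta * n%:R.
Proof.
move=> eta0; have [n0 h] := ln_valid_ext_le eta0.
exists n0 => n n0n; have [A A1 e] := max_nvalid_attained n 3.
have V0 : (0 < #|valid_ext A|)%N.
  by apply: leq_trans (nvalid_le_ext A); rewrite -e max_nvalid_gt0.
have lV : ln ((max_nvalid n 3)%:R : R) <= ln #|valid_ext A|%:R.
  by apply: ler_ln_nat; rewrite max_nvalid_gt0 e nvalid_le_ext.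
have lA : ln (#|valid_ext A|%:R : R) <= #|A|%:R * ln 3.
  by rewrite -lnX_nat //; apply: ler_ln_nat; rewrite V0 card_valid_ext_le.
have := h n A n0n A1 V0; have /andP[l3 l3'] := ln3_bounds R.
have n_ge0 : 0 <= n%:R :> R by [].
have en : 0 <= eta * n%:R by rewrite mulr_ge0 // ltW.
(* For |A| below n / 2 the correction term is negative, and the trivial bound 3^|A| is used
   instead. *)
have [An|An] := leP (n%:R / 2) (#|A|%:R : R); first by lra.
by have : (#|A|%:R : R) * ln 3 <= n%:R / 2 * ln 3; [rewrite ler_wpM2r|]; lra.
Qed.

Lemma max_nvalid_asymptotics : exists e : nat -> R,
  e =o_\oo (fun n : nat => n%:R : R) /\
  forall n : nat, (0 < n)%N -> (max_nvalid n 3)%:R = 3 `^ (n%:R / 2 + e n) :> R.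
Proof.
have /andP[l3 _] := ln3_bounds R.
have l30 : ln 3 != 0 :> R by rewrite gt_eqF //; lra.
(* The exact formula forces e(n) = log_3 f(n, 3) - n / 2. *)
exists (fun n => ln (max_nvalid n 3)%:R / ln 3 - n%:R / 2); split; last first.
  move=> n _; rewrite addrC subrK /powR pnatr_eq0 /= mulfVK //.
  by rewrite lnK // posrE ltr0n max_nvalid_gt0.
apply/eqoP => eps0 eps0_gt0; pose eps : R := eps0.
have eps2 : 0 < eps / 2 by rewrite divr_gt0.
have [n0 h] := ln_max_nvalid_le eps2.
rewrite -[eps0]/eps.
near=> n; have /h hn : (n0 <= n)%N by near: n; exact: nbhs_infty_ge.
have := ln_max_nvalid_ge n => hn'.
rewrite /= [`|n%:R|]ger0_norm // ger0_norm; last first.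
  by rewrite subr_ge0 ler_pdivlMr //; lra.
rewrite lerBlDr ler_pdivrMr; last by lra.
have en : 0 <= eps * n%:R by rewrite mulr_ge0 // ltW.
move: hn; rewrite -/eps; have := ler_wpM2l en l3; rewrite mulrDl; clearbody eps; lra.
Unshelve. all: by end_near.
Qed.

Lemma near_extremal_structure (eps : R) : 0 < eps -> exists (delta : R) (n0 : nat),
  [/\ 0 < delta, (0 < n0)%N & forall (n : nat) (A : {set 'I_n.+1}),
    (n0 <= n)%N -> A \subset oneto n ->
    (nvalid A 3)%:R >= (max_nvalid n 3)%:R * 2 `^ (- (delta * n%:R)) :> R ->
    #|symdiff A (oddset n)|%:R <= eps * n%:R \/
    #|symdiff A (uphalfset n)|%:R <= eps * n%:R].
Proof.
move=> eps0.
have [kappa [k0 k1 k2]] : exists kappa : R,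
    [/\ 0 < kappa, kappa <= eps / 100 & kappa <= 1 / 3000].
  exists (Num.min (eps / 100) (1 / 3000)).
  by rewrite lt_min !ge_min !lexx orbT !divr_gt0 ?ltr01 ?ltr0n.
(* Here [eta] serves as delta and k will be about kappa n. The factor 700 exceeds 9 * 73 = 657, the
   multiple of x = eta n that k disjoint triples would allow for k. *)
have [eta ke] : exists eta : R, kappa = 700 * eta.
  by exists (kappa / 700); rewrite mulrCA divff ?mulr1 ?pnatr_eq0.
have eta0 : 0 < eta by move: k0; rewrite ke pmulr_rgt0 ?ltr0n.
have [n1 h] := ln_valid_ext_le eta0.
pose n2 := Num.bound (200 / eps).
exists eta, (maxn n1 (maxn n2 4000)).+1; split=> // n A.
rewrite !gtn_max => /and3P[n1n n2n n4n] A1 big.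
have n2n' : 200 <= eps * n%:R.
  rewrite mulrC -ler_pdivrMr //; apply: le_trans (ltW (archi_boundP _)) _.
    by rewrite divr_ge0 ?ler0n // ltW.
  by rewrite ler_nat ltnW.
have n4n' : 4000 <= n%:R :> R by rewrite ler_nat ltnW.
clear n2n n4n.
have [x xE] : exists x : R, x = eta * n%:R by exists (eta * n%:R).
have x0 : 0 <= x by rewrite xE mulr_ge0 // ltW.
rewrite -xE in big.
have nv0 : (0 < nvalid A 3)%N.
  rewrite -(ltr0n R); apply: lt_le_trans big.
  by rewrite mulr_gt0 ?powR_gt0 ?ltr0n ?max_nvalid_gt0.
have V0 : (0 < #|valid_ext A|)%N by apply: leq_trans (nvalid_le_ext A).
have /andP[l3 l3'] := ln3_bounds R.
have /andP[l2 l2'] := ln2_bounds R.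
have U : n%:R / 2 * ln 3 - x <= ln (#|valid_ext A|%:R : R).
  apply: le_trans (_ : ln ((nvalid A 3)%:R : R) <= _); last first.
    by apply: ler_ln_nat; rewrite nv0 nvalid_le_ext.
  apply: le_trans (_ : ln ((max_nvalid n 3)%:R * 2 `^ (- x)) <= _); last first.
    by rewrite ler_ln ?posrE ?ltr0n // mulr_gt0 ?powR_gt0 ?ltr0n ?max_nvalid_gt0.
  rewrite lnM ?posrE ?powR_gt0 ?ltr0n ?max_nvalid_gt0 // ln_powR.
  have := ln_max_nvalid_ge n; have := ler_wpM2l x0 l2'; lra.
have cA : #|A|%:R <= n%:R / 2 + 36 * x :> R.
  have := h n A (ltnW n1n) A1 V0; rewrite -xE; lra.
pose k := (Num.truncn (kappa * n%:R)).+1.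
have kn0 : 0 <= kappa * n%:R by rewrite mulr_ge0 // ltW.
have /andP[kl ku] := truncn_itv kn0.
have kl' : k%:R <= kappa * n%:R + 1 by rewrite /k -natr1 lerD2r.
have ku' : 700 * x <= k%:R.
  by apply: le_trans (ltW ku); rewrite ke xE mulrA.
have [[C [CA sf cC]]|few] := disjoint_triples k A; last first.
  (* The triples would give k / 9 <= x + 36 x ln 3 <= 73 x, against k >= 700 x and k >= 1. *)
  exfalso; have := @ler_ln_nat R _ _ (introT andP (conj _ few)).
  rewrite muln_gt0 V0 expn_gt0 => /(_ isT).
  rewrite !lnM_nat ?expn_gt0 // !lnX_nat //.
  have := ler_wpM2l (ler0n R k) (ln98_bound R).
  have : #|A|%:R * ln 3 <= (n%:R / 2 + 36 * x) * ln 3 :> R by rewrite ler_wpM2r //; lra.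
  have := ler_wpM2l x0 l3'.
  have : 1 <= k%:R :> R by rewrite ler1n.
  rewrite mulrBr mulrDl; lra.
have cA' : n%:R / 2 - 2 * x <= #|A|%:R :> R.
  have lA : ln (#|valid_ext A|%:R : R) <= #|A|%:R * ln 3.
    by rewrite -lnX_nat //; apply: ler_ln_nat; rewrite V0 card_valid_ext_le.
  have xl3 := ler_wpM2l x0 l3.
  rewrite -(@ler_pM2r _ (ln 3)); last exact: lt_le_trans (divr_gt0 _ _) l3.
  rewrite mulrBl; lra.
have cAC : (#|A| = #|C| + #|A :\: C|)%N.
  by rewrite -(finset.cardsID C A) (finset.setIidPr CA).
(* Deleting at most 3k elements costs 12k, and the deficit 8 x of 4 |A| from 2n is at most k. *)
have tC : (2 * n <= 4 * #|C| + 13 * k)%N.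
  rewrite -(ler_nat R) natrD !natrM.
  have : #|A|%:R = #|C|%:R + #|A :\: C|%:R :> R by rewrite cAC natrD.
  have : #|A :\: C|%:R <= 3 * k%:R :> R by rewrite -natrM ler_nat.
  lra.
have t100 : (100 * (13 * k + 4) <= n)%N.
  rewrite -(ler_nat R) !(natrM, natrD).
  have : kappa * n%:R <= 1 / 3000 * n%:R by rewrite ler_wpM2r.
  lra.
have C1 : C \subset oneto n by apply: fintype.subset_trans CA A1.
(* The deleted elements contribute 3k and stability 39k + 20; kappa <= eps / 100 and eps n >= 200
   absorb the total. *)
have fin (X : {set 'I_n.+1}) : (#|symdiff C X| <= 3 * (13 * k) + 20)%N ->
    #|symdiff A X|%:R <= eps * n%:R.
  move=> cX; have : (#|symdiff A X| <= 42 * k + 20)%N.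
    apply: leq_trans (card_symdiff_trans X CA) (leq_trans (leq_add cC cX) _).
    by rewrite addnA leq_add2r mulnA -mulnDl.
  rewrite -(ler_nat R) natrD natrM.
  have : kappa * n%:R <= eps / 100 * n%:R by rewrite ler_wpM2r.
  lra.
by case: (sum_free_stability C1 sf tC t100) => /fin; [left|right].
Qed.

End Main.

Theorem theorem1p2 (R : realType) :
  (exists e : nat -> R,
      e =o_\oo (fun n : nat => n%:R : R) /\
      forall n : nat, (0 < n)%N ->
        (max_nvalid n 3)%:R = 3 `^ (n%:R / 2 + e n) :> R) /\
  (forall eps : R, 0 < eps ->
     exists (delta : R) (n0 : nat),
       [/\ 0 < delta, (0 < n0)%N &
         forall (n : nat) (A : {set 'I_n.+1}),
           (n0 <= n)%N -> A \subset oneto n ->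
           (nvalid A 3)%:R >= (max_nvalid n 3)%:R * 2 `^ (- (delta * n%:R)) :> R ->
           #|symdiff A (oddset n)|%:R <= eps * n%:R \/
           #|symdiff A (uphalfset n)|%:R <= eps * n%:R]).
Proof.
split; first exact: max_nvalid_asymptotics.
exact: near_extremal_structure.
Qed.
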